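(* Let $(e^{tA})_{t\ge0}$ be an individually eventually positive $C_0$-semigroup on a complex Banach lattice $E$. Suppose that $s(A)>-\infty$ is a pole of the resolvent $R(\cdot,A)$ of order $m\in\mathbb{N}$. Then: (i) The number $s(A)$ is an eigenvalue of $A$ admitting a positive eigenvector. (ii) Every pole of $R(\cdot,A)$ in $\sigma_{\mathrm{per}}(A)$ has order at most $m$.
   Context: A complex Banach lattice $E$ is the complexification of a real Banach lattice $E_{\mathbb{R}}$; $f\ge0$ (''positive'') means $f$ lies in the positive cone $E_+$ of $E_{\mathbb{R}}$. A $C_0$-semigroup $(e^{tA})_{t\ge0}$ with generator $A$ is individually eventually positive if for each $f\ge 0$ in $E$ there is $t_0\ge0$ such that $e^{tA}f\ge0$ for all $t\ge t_0$. $R(\lambda,A)=(\lambda I-A)^{-1}$; $s(A)=\sup\{\operatorname{Re}\lambda:\lambda\in\sigma(A)\}$ is the spectral bound; $\sigma_{\mathrm{per}}(A)=\sigma(A)\cap(s(A)+i\mathbb{R})$. *)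

(* Defs.v *)
From Stdlib Require Import Reals Relations.
From Coquelicot Require Import Coquelicot.

Open Scope R_scope.

(** * Real and complex Banach lattices *)

Definition is_sup {X : Type} (le : relation X) (S : X -> Prop) (z : X) : Prop :=
  (forall x, S x -> le x z) /\ (forall w, (forall x, S x -> le x w) -> le z w).

(* Binary infima need not be postulated: in an ordered vector space
   inf {x, y} = - sup {- x, - y}. *)
Record BanachLattice := {
  bl_space :> CompleteNormedModule R_AbsRing;
  bl_le : relation bl_space;
  bl_join : bl_space -> bl_space -> bl_space;
  bl_order : order bl_space bl_le;
  bl_le_plus : forall x y z, bl_le x y -> bl_le (plus x z) (plus y z);
  bl_le_scal : forall (a : R) x y, 0 <= a -> bl_le x y -> bl_le (scal a x) (scal a y);
  bl_joinP : forall x y, is_sup bl_le (fun w => w = x \/ w = y) (bl_join x y);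
  bl_norm_mono : forall x y,
    bl_le (bl_join x (opp x)) (bl_join y (opp y)) -> norm x <= norm y
}.

(* |x + i y| = sup_theta (cos theta x + sin theta y). *)
Definition is_modulus (X : BanachLattice) (x y m : X) : Prop :=
  is_sup (bl_le X)
    (fun w => exists theta : R,
       w = plus (scal (cos theta) x) (scal (sin theta) y)) m.

(* The complexification of a real Banach lattice [cbl_real], presented up to
   isometric isomorphism: a complex Banach space that is the direct sum
   E_R + i E_R of an embedded copy of E_R and its multiple by i, with norm
   || x + i y || = || |x + i y| ||.  The modulus exists in every Banach
   lattice, so requiring its existence in [cbl_norm] is no restriction. *)
Record ComplexBanachLattice := {
  cbl_space :> CompleteNormedModule C_AbsRing;
  cbl_real : BanachLattice;
  cbl_emb : cbl_real -> cbl_space;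
  cbl_emb_plus : forall x y, cbl_emb (plus x y) = plus (cbl_emb x) (cbl_emb y);
  cbl_emb_scal : forall (a : R) x,
    cbl_emb (scal a x) = scal (RtoC a : C_AbsRing) (cbl_emb x);
  cbl_decomp : forall z, exists! p : cbl_real * cbl_real,
    z = plus (cbl_emb (fst p)) (scal (Ci : C_AbsRing) (cbl_emb (snd p)));
  cbl_norm : forall x y, exists m : cbl_real,
    is_modulus cbl_real x y m /\
    norm (plus (cbl_emb x) (scal (Ci : C_AbsRing) (cbl_emb y))) = norm m
}.

Definition is_positive {E : ComplexBanachLattice} (f : E) : Prop :=
  exists u : cbl_real E, bl_le _ zero u /\ f = cbl_emb E u.

(** * Unbounded operators

    An operator A : D(A) -> E is represented by its graph, so [A x y] means
    that x lies in D(A) and A x = y.  Bounded operators are functions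
    satisfying Coquelicot's [is_linear], which includes boundedness. *)

Section Operators.

Context {E : CompleteNormedModule C_AbsRing}.
Implicit Types (A : E -> E -> Prop) (lambda : C_AbsRing).

Definition is_eigenvector A lambda (f : E) : Prop :=
  f <> zero /\ A f (scal lambda f).

(* B = R(lambda, A) = (lambda I - A)^{-1}, as a bounded everywhere defined
   operator. *)
Definition is_resolvent A lambda (B : E -> E) : Prop :=
  is_linear B /\
  (forall f, exists g, A (B f) g /\ minus (scal lambda (B f)) g = f) /\
  (forall x y, A x y -> B (minus (scal lambda x) y) = x).

Definition spectrum A lambda : Prop := ~ exists B, is_resolvent A lambda B.

(* The supremum of the empty set is [m_infty]. *)
Definition spectral_bound A : Rbar :=
  Lub_Rbar (fun r => exists lambda, spectrum A lambda /\ r = Re lambda).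

Definition peripheral_spectrum A lambda : Prop :=
  spectrum A lambda /\ Finite (Re lambda) = spectral_bound A.

Definition converges_in_operator_norm (L : nat -> E -> E) (B : E -> E) : Prop :=
  forall eps : posreal,
    eventually (fun N => forall f, norm (minus (L N f) (B f)) <= eps * norm f).

(* Laurent expansion about mu: on a punctured disc the resolvent exists and
     R(lambda, A) = sum_(n >= 0) (lambda - mu)^(n - m) U_n
   in operator norm, with bounded U_n and leading coefficient U_0 <> 0. *)
Definition is_resolvent_pole A (mu : C_AbsRing) (m : nat) : Prop :=
  (1 <= m)%nat /\
  exists (r : posreal) (U : nat -> E -> E),
    (forall n, is_linear (U n)) /\
    (exists f, U 0%nat f <> zero) /\
    forall lambda : C, 0 < Cmod (lambda - mu)%C < r ->
      exists B, is_resolvent A lambda B /\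
        converges_in_operator_norm
          (fun N f => sum_n (fun n =>
             scal (((lambda - mu) ^ n / (lambda - mu) ^ m)%C : C_AbsRing)
               (U n f)) N)
          B.

(** * C_0-semigroups; only the values at t >= 0 matter. *)

Record C0_semigroup (T : R -> E -> E) : Prop := {
  c0_bounded : forall t, 0 <= t -> is_linear (T t);
  c0_zero : forall f, T 0 f = f;
  c0_plus : forall s t f, 0 <= s -> 0 <= t -> T (s + t) f = T s (T t f);
  c0_cont : forall f, filterlim (fun t => T t f) (at_right 0) (locally f)
}.

Definition generator (T : R -> E -> E) (f g : E) : Prop :=
  filterlim (fun t => scal (RtoC (/ t) : C_AbsRing) (minus (T t f) f))
    (at_right 0) (locally g).

End Operators.

Definition individually_eventually_positive {E : ComplexBanachLattice}
    (T : R -> E -> E) : Prop :=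
  forall f : E, is_positive f ->
    exists t0, 0 <= t0 /\ forall t, t0 <= t -> is_positive (T t f).

(* Main.v *)
(* After a time [t0] the orbit of a positive vector lies in the closed cone [K] of vectors whose
   whole orbit is positive.  For large real [l], [R(l, A)] is a Neumann series in [exp (-l) T(1)]
   applied to the integral of [exp (-l r) T(r)] over [0, 1], so it preserves [K]; by Neumann
   series in [R(l, A)] this propagates to every real [l > s(A)].  On [K] it follows, by expanding
   at a far point [l1] of the real axis, that [|| R(s + e + i b) g || <= 2 || R(s + e/2) g ||].
   The leading coefficient [V] of a pole [mu] maps into the eigenspace of [mu], on which
   [T(t0) = exp (mu t0)], and commutes with [T(t0)], so both claims may be tested on [T(t0) f]
   in place of [f]: positivity of [R(s + e)] on [K] makes [U (T(t0) f)] positive, and the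
   domination forces [V (T(t0) f) = 0] when the order of the pole exceeds [m].  No Laplace
   representation of the resolvent up to [s(A)] is needed. *)

Require Import Defs.
From Stdlib Require Import Reals Lra Lia List Relations Classical ClassicalEpsilon.
From Coquelicot Require Import Coquelicot.

Open Scope R_scope.

Set Bullet Behavior "Strict Subproofs".

(** * Linear identities in modules *)

(** The time after which an orbit is positive depends on the vector, so neither the semigroup nor
    [R(l, A)] need preserve the positive cone, not even for large [l]. On [K] all times are good,
    but [K] may be small: it is not known to span the space, which is why a leading coefficient has
    to be pulled back along [T(t0)], a map that acts on its range as a nonzero scalar. Nor is [K]
    known to be a lattice cone: a complex combination of elements of [K] has no modulus to compare
    with and is estimated through its real and imaginary parts, whence the factor 2. The half step
    in [s + e/2] has a geometric reason. The disc about a real [l1] with leftmost point [s + e]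
    meets the line [Re = s + e] only at its real point and so misses [s + e + i b]. With leftmost
    point [s + e/2] it contains [s + e + i b] as soon as [l1] is large in terms of [b] and [e]. At a
    pole of order [m] this shift costs only the constant [2 ^ m], which does not affect the
    comparison of orders. *)

Inductive mexp (K : Type) : Type :=
| Mvar : nat -> mexp K
| Mzero : mexp K
| Mplus : mexp K -> mexp K -> mexp K
| Mopp : mexp K -> mexp K
| Mscal : K -> mexp K -> mexp K.

Arguments Mvar {K} _.
Arguments Mzero {K}.
Arguments Mplus {K} _ _.
Arguments Mopp {K} _.
Arguments Mscal {K} _ _.

Fixpoint meval {K : Ring} {V : ModuleSpace K} (l : list V) (e : mexp K) : V :=
  match e with
  | Mvar n => nth n l zero
  | Mzero => zero
  | Mplus a b => plus (meval l a) (meval l b)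
  | Mopp a => opp (meval l a)
  | Mscal k a => scal k (meval l a)
  end.

Fixpoint mcoef {K : Ring} (e : mexp K) (i : nat) : K :=
  match e with
  | Mvar n => if Nat.eqb n i then one else zero
  | Mzero => zero
  | Mplus a b => plus (mcoef a i) (mcoef b i)
  | Mopp a => opp (mcoef a i)
  | Mscal k a => mult k (mcoef a i)
  end.

Fixpoint mcomb {K : Ring} {V : ModuleSpace K} (l : list V) (c : nat -> K) : V :=
  match l with
  | nil => zero
  | x :: l' => plus (scal (c O) x) (mcomb l' (fun i => c (S i)))
  end.

Fixpoint mcoef_eq {K : Ring} (n : nat) (e1 e2 : mexp K) : Prop :=
  match n with
  | O => True
  | S n' => mcoef e1 n' = mcoef e2 n' /\ mcoef_eq n' e1 e2
  end.

Lemma plus_swap4 {G : AbelianMonoid} (a b c d : G) :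
  plus (plus a b) (plus c d) = plus (plus a c) (plus b d).
Proof.
  rewrite <- !plus_assoc. f_equal. rewrite !plus_assoc. f_equal. apply plus_comm.
Qed.

Section ModuleTactic.

Context {K : Ring} {V : ModuleSpace K}.

Lemma mcomb_ext (l : list V) (c d : nat -> K) :
  (forall i, (i < length l)%nat -> c i = d i) -> mcomb l c = mcomb l d.
Proof.
  revert c d; induction l as [|x l IH]; intros c d H; simpl; auto.
  rewrite (H O) by (simpl; lia). f_equal. apply IH. intros i Hi. apply H. simpl; lia.
Qed.

Lemma mcomb_zero (l : list V) : mcomb l (fun _ => zero) = zero.
Proof.
  induction l as [|x l IH]; simpl; auto. rewrite IH, scal_zero_l. apply plus_zero_l.
Qed.

Lemma mcomb_plus (l : list V) (c d : nat -> K) :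
  mcomb l (fun i => plus (c i) (d i)) = plus (mcomb l c) (mcomb l d).
Proof.
  revert c d; induction l as [|x l IH]; intros c d; simpl.
  - symmetry. apply plus_zero_l.
  - rewrite (IH (fun i => c (S i)) (fun i => d (S i))), scal_distr_r. apply plus_swap4.
Qed.

Lemma mcomb_scal (l : list V) (k : K) (c : nat -> K) :
  mcomb l (fun i => mult k (c i)) = scal k (mcomb l c).
Proof.
  revert c; induction l as [|x l IH]; intros c; simpl.
  - symmetry. apply @scal_zero_r.
  - rewrite (IH (fun i => c (S i))), scal_distr_l. f_equal. symmetry. apply scal_assoc.
Qed.

Lemma mcomb_opp (l : list V) (c : nat -> K) :
  mcomb l (fun i => opp (c i)) = opp (mcomb l c).
Proof.
  rewrite <- (scal_opp_one (mcomb l c)), <- mcomb_scal. apply mcomb_ext. intros i _.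
  rewrite <- opp_mult_l, mult_one_l. reflexivity.
Qed.

Lemma mcomb_var (l : list V) (n : nat) :
  mcomb l (fun i => if Nat.eqb n i then one else zero) = nth n l zero.
Proof.
  revert n; induction l as [|x l IH]; intros [|n]; simpl; auto.
  - rewrite mcomb_zero, scal_one. apply plus_zero_r.
  - rewrite IH, scal_zero_l. apply plus_zero_l.
Qed.

Lemma meval_mcomb (l : list V) (e : mexp K) : meval l e = mcomb l (mcoef e).
Proof.
  induction e as [n| |a IHa b IHb|a IHa|k a IHa]; simpl.
  - symmetry. apply mcomb_var.
  - symmetry. apply mcomb_zero.
  - rewrite IHa, IHb. symmetry. apply mcomb_plus.
  - rewrite IHa. symmetry. apply mcomb_opp.
  - rewrite IHa. symmetry. apply mcomb_scal.
Qed.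

(** Reflection: both sides are combinations of the same atoms, so an identity between vectors
    reduces to finitely many identities between scalars, which [ring] or [field] can decide. *)
Lemma meval_eq (l : list V) (e1 e2 : mexp K) :
  mcoef_eq (length l) e1 e2 -> meval l e1 = meval l e2.
Proof.
  intros H. rewrite !meval_mcomb. apply mcomb_ext.
  revert H; generalize (length l) as n; induction n as [|n IH]; intros H i Hi; [lia|].
  destruct H as [H1 H2]. destruct (Nat.eq_dec i n) as [->|]; auto. apply IH; auto; lia.
Qed.

End ModuleTactic.

Ltac m_mem x l :=
  lazymatch l with
  | nil => constr:(false)
  | x :: _ => constr:(true)
  | _ :: ?l' => m_mem x l'
  end.

Ltac m_atoms e l :=
  lazymatch e with
  | plus ?a ?b => let l1 := m_atoms a l in m_atoms b l1
  | minus ?a ?b => let l1 := m_atoms a l in m_atoms b l1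
  | opp ?a => m_atoms a l
  | scal _ ?a => m_atoms a l
  | zero => l
  | _ => let b := m_mem e l in
         lazymatch b with true => l | false => constr:(e :: l) end
  end.

Ltac m_find x l :=
  lazymatch l with
  | x :: _ => constr:(O)
  | _ :: ?l' => let n := m_find x l' in constr:(S n)
  end.

Ltac m_reify K e l :=
  lazymatch e with
  | plus ?a ?b => let x := m_reify K a l in let y := m_reify K b l in
                  constr:(@Mplus K x y)
  | minus ?a ?b => let x := m_reify K a l in let y := m_reify K b l in
                   constr:(@Mplus K x (@Mopp K y))
  | opp ?a => let x := m_reify K a l in constr:(@Mopp K x)
  | scal ?k ?a => let x := m_reify K a l in constr:(@Mscal K k x)
  | zero => constr:(@Mzero K)
  | _ => let n := m_find e l in constr:(@Mvar K n)
  end.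

Ltac module_over K V :=
  lazymatch goal with
  | |- ?a = ?b =>
    let l0 := m_atoms a (@nil (ModuleSpace.sort K V)) in
    let l := m_atoms b l0 in
    let x := m_reify (Ring.sort K) a l in
    let y := m_reify (Ring.sort K) b l in
    change (@meval K V l x = @meval K V l y);
    apply meval_eq; cbn [mcoef_eq mcoef length Nat.eqb]; repeat split
  end.

Ltac c_ring :=
  cbn; match goal with |- @eq _ ?a ?b => change (@eq C a b) end;
  try ring.
Ltac r_ring :=
  cbn; match goal with |- @eq _ ?a ?b => change (@eq R a b) end;
  try ring.

(** The type of the equation shows only a projection of the structure. The match recovers the
    complete normed module behind it, so that operations from all levels of the hierarchy are
    reified over one module. Coefficient goals that [ring] leaves open are passed on, typically to
    [field]. *)
Ltac cmodule :=
  lazymatch goal with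
  | |- @eq ?T _ _ =>
    match T with
    | context [?X] =>
      lazymatch type of X with
      | CompleteNormedModule.type C_AbsRing =>
        module_over C_Ring (CompleteNormedModule.ModuleSpace C_AbsRing X)
      end
    end; c_ring
  end.

Ltac rmodule :=
  lazymatch goal with
  | |- @eq ?T _ _ =>
    match T with
    | context [?X] =>
      lazymatch type of X with
      | CompleteNormedModule.type R_AbsRing =>
        module_over R_Ring (CompleteNormedModule.ModuleSpace R_AbsRing X)
      end
    end; r_ring
  end.

(** * Norm estimates and limits in normed modules *)

Lemma eq_zero_of_norm_lt {K : AbsRing} {V : CompleteNormedModule K} (x : V) :
  (forall eps, 0 < eps -> norm x < eps) -> x = zero.
Proof.
  intros H. refine (@norm_eq_zero K V x _). apply Rle_antisym; [|apply norm_ge_0].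
  apply Rnot_lt_le. intros Hlt. apply (Rlt_irrefl (norm x)). apply H. exact Hlt.
Qed.

Section NormLemmas.

Context {K : AbsRing} {V : CompleteNormedModule K}.
Implicit Types x y z : V.

Lemma nrm_opp x : norm (opp x) = norm x.
Proof. exact (norm_opp x). Qed.

Lemma nrm_plus x y : norm (plus x y) <= norm x + norm y.
Proof. exact (norm_triangle x y). Qed.

Lemma nrm_minus x y : norm (minus x y) <= norm x + norm y.
Proof. rewrite <- (nrm_opp y). exact (norm_triangle x (opp y)). Qed.

Lemma nrm_zero : norm (zero : V) = 0.
Proof. exact (@norm_zero K V). Qed.

Lemma nrm_minus_sym x y : norm (minus x y) = norm (minus y x).
Proof. rewrite <- (nrm_opp (minus y x)). f_equal. symmetry. exact (@opp_minus V y x). Qed.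

Lemma nrm_minus_trans y x z : norm (minus x z) <= norm (minus x y) + norm (minus y z).
Proof.
  assert (e : minus x z = plus (minus x y) (minus y z)) by exact (@minus_trans V y x z).
  rewrite e. apply nrm_plus.
Qed.

Lemma nrm_le_plus_minus x y : norm x <= norm y + norm (minus x y).
Proof.
  assert (e : x = plus y (minus x y)).
  { symmetry. unfold minus. etransitivity; [apply (@plus_comm V)|].
    etransitivity; [symmetry; apply (@plus_assoc V)|].
    etransitivity; [apply f_equal; apply (@plus_opp_l V)|]. apply (@plus_zero_r V). }
  rewrite e at 1. apply nrm_plus.
Qed.

Lemma eq_of_norm_lt x y :
  (forall eps, 0 < eps -> norm (minus x y) < eps) -> x = y.
Proof.
  intros H. apply eq_zero_of_norm_lt in H.
  apply (@plus_reg_r V (opp y)). etransitivity; [exact H|]. symmetry. apply (@plus_opp_r V).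
Qed.

Lemma filterlim_norm_iff {T} {F : (T -> Prop) -> Prop} {FF : Filter F} (f : T -> V) l :
  filterlim f F (locally l) <-> forall eps, 0 < eps -> F (fun t => norm (minus (f t) l) < eps).
Proof.
  rewrite (@filterlim_locally_ball_norm K T V F FF f l). split.
  - intros H eps Heps. exact (H (mkposreal eps Heps)).
  - intros H eps. exact (H eps (cond_pos eps)).
Qed.

End NormLemmas.

Local Notation "c *: x" := (@scal C_AbsRing _ c%C x) (at level 40, left associativity).

(** * Positivity in Banach lattices *)

Section LatticeOrder.

Context {X : BanachLattice}.
Implicit Types x y z w p : X.

Notation le := (bl_le X).

Definition babs x : X := bl_join X x (opp x).

Lemma le_refl_X x : le x x.
Proof. apply (ord_refl _ _ (bl_order X)). Qed.

Lemma le_trans_X x y z : le x y -> le y z -> le x z.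
Proof. apply (ord_trans _ _ (bl_order X)). Qed.

Lemma le_antisym_X x y : le x y -> le y x -> x = y.
Proof. apply (ord_antisym _ _ (bl_order X)). Qed.

Lemma le_zero_eq x y : le zero x -> x = y -> le zero y.
Proof. intros H <-. exact H. Qed.

Lemma le_minus_zero x y : le x y <-> le zero (minus y x).
Proof.
  split; intros H; [apply (bl_le_plus X _ _ (opp x)) in H|apply (bl_le_plus X _ _ x) in H].
  - assert (e : plus x (opp x) = zero) by rmodule.
    rewrite e in H. exact H.
  - assert (e1 : plus zero x = x) by rmodule.
    assert (e2 : plus (minus y x) x = y) by rmodule.
    rewrite <- e1, <- e2. exact H.
Qed.

Lemma le_zero_plus x y : le zero x -> le zero y -> le zero (plus x y).
Proof.
  intros Hx Hy. apply le_trans_X with y; auto.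
  apply le_minus_zero. apply (le_zero_eq x); [|rmodule]. exact Hx.
Qed.

Lemma le_zero_scal (a : R) x : 0 <= a -> le zero x -> le zero (scal a x).
Proof.
  intros Ha Hx. apply (bl_le_scal X a) in Hx; auto.
  assert (e : scal a (zero : X) = zero) by rmodule. rewrite e in Hx. exact Hx.
Qed.

Lemma babs_ge x : le x (babs x).
Proof. apply (bl_joinP X x (opp x)); auto. Qed.

Lemma babs_ge_opp x : le (opp x) (babs x).
Proof. apply (bl_joinP X x (opp x)); auto. Qed.

Lemma babs_lub x w : le x w -> le (opp x) w -> le (babs x) w.
Proof. intros H1 H2. apply (bl_joinP X x (opp x)). intros y [->| ->]; auto. Qed.

Lemma le_zero_of_opp_le x w : le x w -> le (opp x) w -> le zero w.
Proof.
  intros H1%le_minus_zero H2%le_minus_zero.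
  apply (le_zero_eq (scal (/2) (plus (minus w x) (minus w (opp x))))); [|rmodule; field].
  apply le_zero_scal; [lra|]. apply le_zero_plus; auto.
Qed.

Lemma babs_of_pos x : le zero x -> babs x = x.
Proof.
  intros Hx. apply le_antisym_X; [|apply babs_ge].
  apply babs_lub; [apply le_refl_X|].
  apply le_minus_zero. apply (le_zero_eq (plus x x)); [|rmodule].
  apply le_zero_plus; auto.
Qed.

Lemma norm_le_of_between x p : le x p -> le (opp x) p -> norm x <= norm p.
Proof.
  intros H1 H2. apply bl_norm_mono.
  change (le (babs x) (babs p)). rewrite (babs_of_pos p).
  - apply babs_lub; auto.
  - apply le_zero_of_opp_le with x; auto.
Qed.

Lemma norm_babs x : norm (babs x) = norm x.
Proof.
  assert (H : babs (babs x) = babs x).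
  { apply babs_of_pos. eapply le_zero_of_opp_le; [apply babs_ge|apply babs_ge_opp]. }
  apply Rle_antisym; apply bl_norm_mono;
    [change (le (babs (babs x)) (babs x))|change (le (babs x) (babs (babs x)))];
    rewrite H; apply le_refl_X.
Qed.

(** Closedness of the positive cone. The negative part [n] of [x] satisfies [0 <= n <= |p - x|] for
    every positive [p], because [- x <= p - x]; monotonicity of the norm then makes [n] arbitrarily
    small. *)
Lemma pos_of_approx x :
  (forall eps, 0 < eps -> exists p, le zero p /\ norm (minus p x) < eps) -> le zero x.
Proof.
  intros H.
  set (n := bl_join X (opp x) zero).
  assert (Hn1 : le (opp x) n) by (apply (bl_joinP X (opp x) zero); auto).
  assert (Hn0 : le zero n) by (apply (bl_joinP X (opp x) zero); auto).
  assert (Hn : n = zero).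
  { apply eq_zero_of_norm_lt. intros eps Heps. destruct (H eps Heps) as [p [Hp Hd]].
    eapply Rle_lt_trans; [|exact Hd].
    rewrite <- (norm_babs (minus p x)).
    assert (Hnd : le n (babs (minus p x))).
    { apply (bl_joinP X (opp x) zero). intros w [->| ->].
      - apply le_trans_X with (minus p x); [|apply babs_ge].
        apply le_minus_zero. apply (le_zero_eq p); [|rmodule]. auto.
      - eapply le_zero_of_opp_le; [apply babs_ge|apply babs_ge_opp]. }
    apply norm_le_of_between; auto.
    apply le_trans_X with zero.
    - apply le_minus_zero. apply (le_zero_eq n); [|rmodule]. auto.
    - apply le_trans_X with n; auto. }
  rewrite Hn in Hn1. apply le_minus_zero in Hn1.
  apply (le_zero_eq _ _ Hn1). rmodule.
Qed.

Lemma ex_pos_decomp x : exists p q, le zero p /\ le zero q /\ x = minus p q.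
Proof.
  exists (babs x), (minus (babs x) x). repeat split.
  - eapply le_zero_of_opp_le; [apply babs_ge|apply babs_ge_opp].
  - apply le_minus_zero. apply (le_zero_eq (minus (babs x) x)); [|rmodule].
    apply -> le_minus_zero. apply babs_ge.
  - rmodule.
Qed.

Lemma modulus_norm_ge x y m :
  is_modulus X x y m -> norm x <= norm m /\ norm y <= norm m.
Proof.
  intros [H _].
  assert (H0 : le x m).
  { apply H. exists 0. rewrite cos_0, sin_0. rmodule. }
  assert (H1 : le (opp x) m).
  { apply H. exists PI. rewrite cos_PI, sin_PI. rmodule. }
  assert (H2 : le y m).
  { apply H. exists (PI/2). rewrite cos_PI2, sin_PI2. rmodule. }
  assert (H3 : le (opp y) m).
  { apply H. exists (-(PI/2)). rewrite cos_neg, sin_neg, cos_PI2, sin_PI2. rmodule. }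
  split; apply norm_le_of_between; auto.
Qed.

Lemma modulus_real_norm_le x m : is_modulus X x zero m -> norm m <= norm x.
Proof.
  intros [Hub Hlub].
  assert (Hm : le m (babs x)).
  { apply Hlub. intros w [t ->].
    assert (Ha : le zero (babs x))
      by (eapply le_zero_of_opp_le; [apply babs_ge|apply babs_ge_opp]).
    assert (Hx : le zero (minus (babs x) x)) by (apply -> le_minus_zero; apply babs_ge).
    assert (Hx' : le zero (minus (babs x) (opp x)))
      by (apply -> le_minus_zero; apply babs_ge_opp).
    (* Since the cosine lies in [-1, 1], [cos t x] is a convex combination of [x] and [- x], both of
       which are below [|x|]. *)
    apply le_minus_zero. pose proof (COS_bound t).
    apply (le_zero_eq (plus (scal ((1 + cos t) / 2) (minus (babs x) x))
                 (scal ((1 - cos t) / 2) (minus (babs x) (opp x))))); [|rmodule; field].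
    apply le_zero_plus; apply le_zero_scal; auto; lra. }
  assert (H0 : le x m).
  { apply Hub. exists 0. rewrite cos_0, sin_0. rmodule. }
  assert (H1 : le (opp x) m).
  { apply Hub. exists PI. rewrite cos_PI, sin_PI. rmodule. }
  assert (Hm0 : le zero m) by (apply le_zero_of_opp_le with x; auto).
  apply bl_norm_mono. change (le (babs m) (babs x)). rewrite babs_of_pos; auto.
Qed.

End LatticeOrder.

(** * The positive cone of the complexification *)

Section ComplexPositivity.

Context {E : ComplexBanachLattice}.

Definition complex (a b : cbl_real E) : E :=
  plus (cbl_emb E a) (scal (Ci : C_AbsRing) (cbl_emb E b)).

Lemma complex_surj (z : E) : exists a b, z = complex a b.
Proof. destruct (cbl_decomp E z) as [[a b] [H _]]. exists a, b. exact H. Qed.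

Lemma norm_complex_ge a b :
  norm a <= norm (complex a b) /\ norm b <= norm (complex a b).
Proof.
  destruct (cbl_norm E a b) as [m [Hm Hn]]. unfold complex. rewrite Hn.
  apply modulus_norm_ge. exact Hm.
Qed.

Lemma emb_zero : cbl_emb E zero = zero.
Proof.
  transitivity (cbl_emb E (scal 0 zero)); [f_equal; rmodule|].
  rewrite cbl_emb_scal. cmodule.
Qed.

Lemma emb_complex a : cbl_emb E a = complex a zero.
Proof. unfold complex. rewrite emb_zero. cmodule. Qed.

Lemma emb_minus a b : cbl_emb E (minus a b) = minus (cbl_emb E a) (cbl_emb E b).
Proof.
  transitivity (cbl_emb E (plus a (scal (- (1)) b))); [f_equal; rmodule|].
  rewrite cbl_emb_plus, cbl_emb_scal, RtoC_opp. cmodule.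
Qed.

Lemma emb_opp a : cbl_emb E (opp a) = opp (cbl_emb E a).
Proof.
  transitivity (cbl_emb E (scal (- (1)) a)); [f_equal; rmodule|].
  rewrite cbl_emb_scal, RtoC_opp. cmodule.
Qed.

Lemma norm_emb a : norm (cbl_emb E a) = norm a.
Proof.
  rewrite emb_complex. apply Rle_antisym; [|apply norm_complex_ge].
  destruct (cbl_norm E a zero) as [m [Hm Hn]]. unfold complex. rewrite Hn.
  apply modulus_real_norm_le. exact Hm.
Qed.

Lemma pos_zero : is_positive (zero : E).
Proof. exists zero. split; [apply le_refl_X|]. symmetry. apply emb_zero. Qed.

Lemma pos_plus (f g : E) : is_positive f -> is_positive g -> is_positive (plus f g).
Proof.
  intros [u [Hu ->]] [v [Hv ->]]. exists (plus u v).
  split; [apply le_zero_plus; auto|]. symmetry. apply cbl_emb_plus.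
Qed.

Lemma pos_scal (a : R) (f : E) :
  0 <= a -> is_positive f -> is_positive (scal (RtoC a : C_AbsRing) f).
Proof.
  intros Ha [u [Hu ->]]. exists (scal a u).
  split; [apply le_zero_scal; auto|]. symmetry. apply cbl_emb_scal.
Qed.

(** Real and imaginary parts are bounded in norm by the complex vector, so a positive vector close
    to [a + i b] shows that [b] is small and that [a] is close to the real positive cone. Here
    [closed] says that a point belongs to the set unless some neighbourhood avoids the set, hence
    the argument by contradiction. *)
Lemma pos_closed : closed (@is_positive E).
Proof.
  intros z Hz. destruct (complex_surj z) as [a [b ->]].
  assert (Happ : forall eps, 0 < eps -> exists p, bl_le (cbl_real E) zero p /\
     norm (minus p a) < eps /\ norm b < eps).
  { intros eps Heps. apply NNPP. intros Hno. apply Hz.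
    apply (locally_le_locally_norm (complex a b)). exists (mkposreal _ Heps). intros w Hw [u [Hu ->]].
    apply Hno. exists u. change (norm (minus (cbl_emb E u) (complex a b)) < eps) in Hw.
    assert (Hw' : minus (cbl_emb E u) (complex a b) = complex (minus u a) (opp b)).
    { unfold complex. rewrite emb_minus, emb_opp. cmodule. }
    rewrite Hw' in Hw. destruct (norm_complex_ge (minus u a) (opp b)) as [H1 H2].
    rewrite nrm_opp in H2.
    split; auto. split; eapply Rle_lt_trans; eauto. }
  assert (Hb : b = zero).
  { apply eq_zero_of_norm_lt. intros eps Heps. destruct (Happ eps Heps) as [p [_ [_ H]]]. exact H. }
  rewrite Hb, <- emb_complex. exists a. split; auto.
  apply pos_of_approx. intros eps Heps. destruct (Happ eps Heps) as [p [H1 [H2 _]]]. eauto.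
Qed.

(** The hypotheses force [p] and [x] to be real, as half the sum and half the difference of two
    embedded vectors; this brings the claim back to the real lattice. *)
Lemma norm_le_of_pos (x p : E) :
  is_positive (minus p x) -> is_positive (plus p x) -> norm x <= norm p.
Proof.
  intros [u [Hu Hu']] [v [Hv Hv']].
  assert (H2 : RtoC 2 <> 0) by (intros H; injection H; lra).
  assert (Hp : p = cbl_emb E (scal (/2) (plus u v))).
  { rewrite cbl_emb_scal, cbl_emb_plus, <- Hu', <- Hv', RtoC_inv by lra.
    cmodule; field; auto. }
  assert (Hx : x = cbl_emb E (scal (/2) (minus v u))).
  { rewrite cbl_emb_scal, emb_minus, <- Hu', <- Hv', RtoC_inv by lra.
    cmodule; field; auto. }
  rewrite Hp, Hx, !norm_emb. apply norm_le_of_between; apply le_minus_zero.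
  - apply (le_zero_eq u); [auto|rmodule; field].
  - apply (le_zero_eq v); [auto|rmodule; field].
Qed.

Lemma pos_span (f : E) : exists p1 p2 p3 p4 : E,
  is_positive p1 /\ is_positive p2 /\ is_positive p3 /\ is_positive p4 /\
  f = plus (minus p1 p2) (scal (Ci : C_AbsRing) (minus p3 p4)).
Proof.
  destruct (complex_surj f) as [a [b ->]].
  destruct (ex_pos_decomp a) as [a1 [a2 [Ha1 [Ha2 ->]]]].
  destruct (ex_pos_decomp b) as [b1 [b2 [Hb1 [Hb2 ->]]]].
  exists (cbl_emb E a1), (cbl_emb E a2), (cbl_emb E b1), (cbl_emb E b2).
  unfold complex. rewrite !emb_minus.
  repeat split; [exists a1|exists a2|exists b1|exists b2]; auto.
Qed.

End ComplexPositivity.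

(** * Resolvents and closed cones *)

Lemma Cmod_pow (c : C) (n : nat) : Cmod (c ^ n)%C = Cmod c ^ n.
Proof. induction n as [|n IH]; simpl; [apply Cmod_1|]. rewrite Cmod_mult, IH. reflexivity. Qed.

Lemma Cmod_Ci : Cmod Ci = 1.
Proof. unfold Cmod, Ci; simpl. transitivity (sqrt 1); [f_equal; ring|apply sqrt_1]. Qed.

Lemma eventually_geom_lt (q C eps : R) :
  0 <= q < 1 -> 0 <= C -> 0 < eps -> eventually (fun N => q ^ N * C < eps).
Proof.
  intros Hq HC Heps.
  assert (H : is_lim_seq (fun N => q ^ N * C) 0).
  { replace (Finite 0) with (Rbar_mult (Finite 0) C) by (simpl; f_equal; ring).
    apply is_lim_seq_scal_r. apply is_lim_seq_geom. rewrite Rabs_pos_eq; lra. }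
  apply is_lim_seq_spec in H. destruct (H (mkposreal eps Heps)) as [N HN].
  exists N. intros n Hn. specialize (HN n Hn). simpl in HN.
  apply Rabs_def2 in HN. lra.
Qed.

Section ComplexBanach.

Context {E : CompleteNormedModule C_AbsRing}.
Implicit Types (f g x y : E) (c la mu : C) (B : E -> E).

Lemma nrm_scal c x : norm (c *: x) <= Cmod c * norm x.
Proof. exact (norm_scal (c : C_AbsRing) x). Qed.

Lemma nrm_scal_R (a : R) x : 0 <= a -> norm (RtoC a *: x) <= a * norm x.
Proof. intros Ha. apply Rle_trans with (1 := nrm_scal _ _). rewrite Cmod_R, Rabs_pos_eq; auto; lra. Qed.

Lemma linear_iter B n : is_linear B -> is_linear (Nat.iter n B).
Proof.
  intros HB. induction n as [|n IH]; [exact is_linear_id|].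
  apply (is_linear_comp (Nat.iter n B) B); auto.
Qed.

Lemma norm_iter B M n f :
  0 <= M -> (forall h, norm (B h) <= M * norm h) -> norm (Nat.iter n B f) <= M ^ n * norm f.
Proof.
  intros HM HB. induction n as [|n IH]; [simpl; lra|].
  apply Rle_trans with (1 := HB (Nat.iter n B f)). simpl. rewrite Rmult_assoc.
  apply Rmult_le_compat_l; auto.
Qed.

Section Resolvent.

Variable A : E -> E -> Prop.

(** Solved for [B'] in terms of [B], so that substituting it into itself produces the Neumann
    expansion about [la]. *)
Lemma resolvent_identity la mu B B' f :
  is_resolvent A la B -> is_resolvent A mu B' ->
  B' f = plus (B f) ((la - mu) *: B (B' f)).
Proof.
  intros [HB [_ HB2]] [_ [HB1 _]]. destruct (HB1 f) as [g [Hg Hf]].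
  rewrite <- (HB2 _ _ Hg) at 1. rewrite <- (linear_scal _ HB), <- (linear_plus _ HB).
  f_equal. rewrite <- Hf at 2. cmodule.
Qed.

Lemma resolvent_unique la B B' f :
  is_resolvent A la B -> is_resolvent A la B' -> B f = B' f.
Proof.
  intros HB HB'. symmetry. rewrite (resolvent_identity la la B B' f HB HB') at 1. cmodule.
Qed.

Lemma resolvent_commute la mu B B' f :
  is_resolvent A la B -> is_resolvent A mu B' -> B (B' f) = B' (B f).
Proof.
  intros HB HB'. destruct (Ceq_dec la mu) as [<-|Hne].
  - rewrite (resolvent_unique la B B' (B' f) HB HB'). f_equal. symmetry.
    exact (resolvent_unique la B B' f HB HB').
  - assert (H1 := resolvent_identity _ _ _ _ f HB HB').
    assert (H2 := resolvent_identity _ _ _ _ f HB' HB).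
    assert (Hd : (la - mu)%C <> 0) by (apply Cminus_eq_contra; exact Hne).
    assert (e1 : B (B' f) = (/ (la - mu)) *: minus (B' f) (B f)).
    { rewrite H1 at 2. cmodule; field; exact Hd. }
    assert (e2 : B' (B f) = (/ (la - mu)) *: minus (B' f) (B f)).
    { rewrite H2 at 2. cmodule; field; exact Hd. }
    rewrite e1, e2. reflexivity.
Qed.

Lemma resolvent_commute_iter la mu B B' n f :
  is_resolvent A la B -> is_resolvent A mu B' ->
  Nat.iter n B (B' f) = B' (Nat.iter n B f).
Proof.
  intros HB HB'. induction n as [|n IH]; simpl; auto.
  rewrite IH. eapply resolvent_commute; eauto.
Qed.

(** An exact remainder needs no smallness of [la - mu]. It is either estimated in norm or, for the
    domination, recognised as an element of a cone. *)
Lemma resolvent_expansion la mu B B' f N :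
  is_resolvent A la B -> is_resolvent A mu B' ->
  B' f = plus (sum_n (fun n => (la - mu) ^ n *: Nat.iter (S n) B f) N)
              ((la - mu) ^ S N *: Nat.iter (S N) B (B' f)).
Proof.
  intros HB HB'. induction N as [|N IH].
  - rewrite sum_O. rewrite (resolvent_identity _ _ _ _ f HB HB') at 1. simpl. cmodule.
  - rewrite sum_Sn. rewrite IH at 1.
    assert (e : Nat.iter (S N) B (B' f) =
      plus (Nat.iter (S (S N)) B f) ((la - mu) *: Nat.iter (S (S N)) B (B' f))).
    { rewrite (resolvent_identity _ _ _ _ f HB HB') at 1.
      assert (HL := linear_iter B (S N) (proj1 HB)).
      rewrite (linear_plus _ HL), (linear_scal _ HL), <- !Nat.iter_succ_r. reflexivity. }
    rewrite e at 1. generalize (Nat.iter (S (S N)) B f), (Nat.iter (S (S N)) B (B' f)).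
    intros u v. simpl Cpow. cmodule.
Qed.

(** Closedness of [A] in usable form: the graph is cut out by an equation between bounded operators,
    which survives limits. *)
Lemma graph_iff_resolvent la B x y :
  is_resolvent A la B -> (A x y <-> x = B (minus (la *: x) y)).
Proof.
  intros [_ [H1 H2]]. split.
  - intros H. symmetry. apply H2. exact H.
  - intros H. destruct (H1 (minus (la *: x) y)) as [g [Hg He]].
    rewrite <- H in Hg, He.
    assert (e : g = y).
    { transitivity (minus (la *: x) (minus (la *: x) g)); [cmodule|]. rewrite He. cmodule. }
    rewrite <- e. exact Hg.
Qed.

End Resolvent.

(** Kept abstract because the cone to which it is applied is [stays_positive] and not the positive
    cone itself. *)
Record closed_cone (K : E -> Prop) : Prop := {
  cone_zero : K zero;
  cone_plus : forall x y, K x -> K y -> K (plus x y);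
  cone_scal : forall (a : R) x, 0 <= a -> K x -> K (RtoC a *: x);
  cone_closed : closed K
}.

Definition preserves (K : E -> Prop) B := forall g, K g -> K (B g).

Section Cone.

Variable K : E -> Prop.
Hypothesis HK : closed_cone K.

Lemma cone_eq x y : K x -> x = y -> K y.
Proof. intros H <-. exact H. Qed.

Lemma cone_lim {T} {F : (T -> Prop) -> Prop} {FF : ProperFilter F} (u : T -> E) l :
  filterlim u F (locally l) -> (forall t, K (u t)) -> K l.
Proof.
  intros Hu Hk. apply (closed_filterlim (F := F) u K l Hu Hk). apply cone_closed, HK.
Qed.

Lemma cone_sum (a : nat -> E) N : (forall n, K (a n)) -> K (sum_n a N).
Proof.
  intros Ha. induction N as [|N IH]; [rewrite sum_O; auto|].
  rewrite sum_Sn. apply (cone_plus _ HK); auto.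
Qed.

Lemma cone_iter B n g : preserves K B -> K g -> K (Nat.iter n B g).
Proof. intros HB Hg. induction n as [|n IH]; simpl; auto. Qed.

Lemma cone_sum_minus (a : nat -> E) N :
  (forall n, K (a n)) -> K (minus (sum_n a N) (a N)).
Proof.
  intros Ha. destruct N as [|N].
  - rewrite sum_O. apply (cone_eq zero); [apply HK|cmodule].
  - rewrite sum_Sn. apply (cone_eq (sum_n a N)); [apply cone_sum; auto|cmodule].
Qed.

Variable A : E -> E -> Prop.

(** As [mu] lies to the left of [la], the coefficients [(la - mu) ^ n] are nonnegative and the
    partial sums stay in [K]. The bound 1/2 makes the remainder tend to zero, and [K] is closed. *)
Lemma resolvent_preserves_near (la mu : R) B B' M :
  is_resolvent A (RtoC la) B -> is_resolvent A (RtoC mu) B' -> mu <= la ->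
  0 <= M -> (forall h, norm (B h) <= M * norm h) -> (la - mu) * M <= 1 / 2 ->
  preserves K B -> preserves K B'.
Proof.
  intros HB HB' Hle HM Hb Hs Hp g Hg.
  apply (cone_lim (F := eventually)
    (fun N => sum_n (fun n => (la - mu) ^ n *: Nat.iter (S n) B g) N)).
  - refine (proj2 (filterlim_norm_iff _ _) _). intros eps Heps.
    assert (Hev : eventually (fun N => (1/2) ^ N * norm (B' g) < eps)).
    { apply eventually_geom_lt; auto; [lra|apply norm_ge_0]. }
    revert Hev. apply filter_imp. intros N HN.
    apply Rle_lt_trans with (norm ((la - mu) ^ S N *: Nat.iter (S N) B (B' g))).
    { right. rewrite <- nrm_opp. apply f_equal.
      rewrite (resolvent_expansion A la mu B B' g N HB HB') at 1. cmodule. }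
    apply Rle_lt_trans with (2 := HN). apply Rle_trans with (1 := nrm_scal _ _).
    rewrite Cmod_pow, <- RtoC_minus, Cmod_R, Rabs_pos_eq by lra.
    apply Rle_trans with ((la - mu) ^ S N * (M ^ S N * norm (B' g))).
    { apply Rmult_le_compat_l; [apply pow_le; lra|]. apply norm_iter; auto. }
    rewrite <- Rmult_assoc, <- Rpow_mult_distr.
    apply Rmult_le_compat_r; [apply norm_ge_0|].
    apply Rle_trans with ((1/2) ^ S N).
    + apply pow_incr. split; auto. apply Rmult_le_pos; lra.
    + simpl. assert (0 <= (1/2) ^ N) by (apply pow_le; lra). lra.
  - intros N. apply cone_sum. intros n. rewrite <- RtoC_minus, <- RtoC_pow.
    apply (cone_scal _ HK); [apply pow_le; lra|]. apply cone_iter; auto.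
Qed.

(* Near a point of the resolvent set the resolvents are uniformly bounded, so the Neumann
   series carries positivity a fixed distance to the left. *)
Lemma resolvent_preserves_left (s L : R) :
  (forall t : R, s < t -> exists B, is_resolvent A (RtoC t) B) ->
  (forall t B, L <= t -> is_resolvent A (RtoC t) B -> preserves K B) ->
  forall (t : R) B, s < t -> is_resolvent A (RtoC t) B -> preserves K B.
Proof.
  intros Hex HL t B Ht HB. apply NNPP. intros Hno.
  (* Let [l] be the supremum of the points where [K] is not preserved. It exceeds [s], so the
     resolvent exists there, and a step to the left from a point just beyond [l] contradicts
     minimality. *)
  set (Z := fun x : R => s < x /\ exists B, is_resolvent A (RtoC x) B /\ ~ preserves K B).
  assert (Hub : bound Z).
  { exists L. intros x [_ [B' [HB' Hn]]]. apply Rnot_lt_le. intros Hlt.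
    apply Hn. apply (HL x); auto. lra. }
  destruct (completeness Z Hub) as [l [Hl1 Hl2]].
  { exists t. split; auto. exists B. auto. }
  assert (Htl : t <= l) by (apply Hl1; split; eauto).
  destruct (Hex l) as [Bl HBl]; [lra|].
  destruct (linear_norm _ (proj1 HBl)) as [M [HM HMb]].
  (* With [d M = 1/4] the resolvent at [l + d] is bounded by [4/3 M]. Stepping down from there to a
     point above [l - d/2] covers a distance below [3/2 d], and [3/2 d * 4/3 M = 1/2] is exactly
     what the preceding lemma allows. *)
  set (d := / (4 * M)).
  assert (Hd : 0 < d) by (apply Rinv_0_lt_compat; lra).
  destruct (Hex (l + d)) as [B1 HB1]; [lra|].
  assert (HB1b : forall h, norm (B1 h) <= (4 / 3 * M) * norm h).
  { intros h.
    assert (Hn := norm_ge_0 (B1 h)). assert (Hh := norm_ge_0 h).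
    assert (H2 : norm (B1 h) <= M * norm h + / 4 * norm (B1 h)).
    { rewrite (resolvent_identity A l (RtoC (l + d)) Bl B1 h HBl HB1) at 1.
      apply Rle_trans with (1 := nrm_plus _ _). apply Rplus_le_compat; auto.
      apply Rle_trans with (1 := nrm_scal _ _). rewrite <- RtoC_minus, Cmod_R.
      replace (l - (l + d)) with (- d) by ring. rewrite Rabs_Ropp, Rabs_pos_eq by lra.
      apply Rle_trans with (d * (M * norm (B1 h))).
      - apply Rmult_le_compat_l; [lra|auto].
      - right. unfold d. field. lra. }
    lra. }
  assert (HP1 : preserves K B1).
  { apply NNPP. intros Hn. assert (l + d <= l); [|lra].
    apply Hl1. split; [lra|]. exists B1. auto. }
  assert (Hlast : l <= l - d / 2); [|lra].
  apply Hl2. intros x Hx. apply Rnot_lt_le. intros Hlt.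
  assert (Hxl := Hl1 x Hx). destruct Hx as [Hsx [B' [HB' Hn]]]. apply Hn.
  apply (resolvent_preserves_near (l + d) x B1 B' (4 / 3 * M) HB1 HB'); auto; try lra.
  apply Rle_trans with ((3/2 * d) * (4 / 3 * M)).
  - apply Rmult_le_compat_r; lra.
  - right. unfold d. field. lra.
Qed.

(** The only link between [K] and the norm. The interval form [- p <= x <= p], in the order of [K],
    avoids a modulus, which this order need not have. *)
Hypothesis norm_le_of_cone :
  forall x p, K (minus p x) -> K (plus p x) -> norm x <= norm p.

Lemma norm_le_of_cone_le x p : K x -> K (minus p x) -> norm x <= norm p.
Proof.
  intros Hx Hp. apply norm_le_of_cone; auto.
  apply (cone_eq (plus (minus p x) (plus x x))); [|cmodule].
  apply (cone_plus _ HK); auto. apply (cone_plus _ HK); auto.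
Qed.

Lemma norm_sum_real_le (p : nat -> E) (r t : nat -> R) N :
  (forall n, K (p n)) -> (forall n, Rabs (t n) <= r n) ->
  norm (sum_n (fun n => RtoC (t n) *: p n) N) <= norm (sum_n (fun n => RtoC (r n) *: p n) N).
Proof.
  intros Hp Ht. apply norm_le_of_cone.
  - apply (cone_eq (sum_n (fun n => RtoC (r n - t n) *: p n) N)).
    + apply cone_sum. intros n. apply (cone_scal _ HK); auto.
      specialize (Ht n). apply Rabs_le_between in Ht. lra.
    + induction N as [|N IH]; [rewrite !sum_O|rewrite !sum_Sn, IH]; rewrite RtoC_minus; cmodule.
  - apply (cone_eq (sum_n (fun n => RtoC (r n + t n) *: p n) N)).
    + apply cone_sum. intros n. apply (cone_scal _ HK); auto.
      specialize (Ht n). apply Rabs_le_between in Ht. lra.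
    + induction N as [|N IH]; [rewrite !sum_O|rewrite !sum_Sn, IH]; rewrite RtoC_plus; cmodule.
Qed.

(** Real and imaginary parts of the coefficients are each bounded by [r], so each half of the sum is
    dominated separately; the triangle inequality gives the factor 2. *)
Lemma norm_sum_le (p : nat -> E) (r : nat -> R) (c : nat -> C) N :
  (forall n, K (p n)) -> (forall n, Cmod (c n) <= r n) ->
  norm (sum_n (fun n => c n *: p n) N) <= 2 * norm (sum_n (fun n => RtoC (r n) *: p n) N).
Proof.
  intros Hp Hc.
  assert (e : sum_n (fun n => c n *: p n) N =
    plus (sum_n (fun n => RtoC (Re (c n)) *: p n) N)
         (Ci *: sum_n (fun n => RtoC (Im (c n)) *: p n) N)).
  { assert (ec : forall z : C, z = (RtoC (Re z) + Ci * RtoC (Im z))%C).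
    { intros [a b]. apply injective_projections; simpl; ring. }
    induction N as [|N IH]; [rewrite !sum_O|rewrite !sum_Sn, IH].
    - rewrite (ec (c O)) at 1. cmodule.
    - rewrite (ec (c (S N))) at 1. cmodule. }
  rewrite e. apply Rle_trans with (1 := nrm_plus _ _).
  assert (H1 := norm_sum_real_le p r (fun n => Re (c n)) N Hp
    (fun n => Rle_trans _ _ _ (Rle_trans _ _ _ (Rmax_l _ _) (Rmax_Cmod (c n))) (Hc n))).
  assert (H2 := norm_sum_real_le p r (fun n => Im (c n)) N Hp
    (fun n => Rle_trans _ _ _ (Rle_trans _ _ _ (Rmax_r _ _) (Rmax_Cmod (c n))) (Hc n))).
  assert (H3 := nrm_scal Ci (sum_n (fun n => RtoC (Im (c n)) *: p n) N)).
  rewrite Cmod_Ci in H3. lra.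
Qed.

(* Both resolvents are expanded at [l1]; the expansion of [Bmu g] has its terms in the cone
   and dominates that of [B g] term by term. *)
Lemma resolvent_domination (mu l1 : R) la Bmu B1 B g :
  is_resolvent A (RtoC mu) Bmu -> is_resolvent A (RtoC l1) B1 -> is_resolvent A la B ->
  Cmod (l1 - la) < l1 - mu ->
  preserves K Bmu -> preserves K B1 -> K g ->
  norm (B g) <= 2 * norm (Bmu g).
Proof.
  intros HBmu HB1 HB Hlt Hpmu Hp1 Hg.
  set (r := l1 - mu) in *. set (c := (l1 - la)%C) in *.
  assert (Hr : 0 < r) by (apply Rle_lt_trans with (2 := Hlt); apply Cmod_ge_0).
  set (p := fun n => Nat.iter (S n) B1 g).
  assert (Hp : forall n, K (p n)) by (intros n; apply cone_iter; auto).
  set (S := fun N => sum_n (fun n => RtoC (r ^ n) *: p n) N).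
  assert (HrS : forall n, K (RtoC (r ^ n) *: p n)).
  { intros n. apply (cone_scal _ HK); auto. apply pow_le; lra. }
  (* The difference is the remainder of the expansion at [l1], namely [r ^ (N + 1)] times a power of
     [B1] applied to [Bmu g]. Both operators preserve [K], so no convergence of the series is
     used. *)
  assert (HS : forall N, K (minus (Bmu g) (S N))).
  { intros N.
    assert (e := resolvent_expansion A l1 mu B1 Bmu g N HB1 HBmu).
    rewrite <- RtoC_minus in e. fold r in e.
    apply (cone_eq (RtoC (r ^ (N + 1)) *: Nat.iter (N + 1) B1 (Bmu g))).
    - apply (cone_scal _ HK); [apply pow_le; lra|]. apply cone_iter; auto.
    - rewrite e at 2. rewrite Nat.add_1_r.
      assert (e2 : S N = sum_n (fun n => RtoC r ^ n *: Nat.iter (Datatypes.S n) B1 g) N).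
      { apply sum_n_ext. intros n. rewrite RtoC_pow. reflexivity. }
      rewrite e2, RtoC_pow. cmodule. }
  assert (HSn : forall N, norm (S N) <= norm (Bmu g)).
  { intros N. apply norm_le_of_cone_le; auto. apply cone_sum; auto. }
  (* A single term lies below the partial sum that contains it, hence below [Bmu g]. This growth
     bound on the powers of [B1] at [g] replaces a spectral radius estimate. *)
  assert (Hpn : forall N, r ^ N * norm (p N) <= norm (Bmu g)).
  { intros N. assert (Hpow : 0 < r ^ N) by (apply pow_lt; auto).
    apply Rle_trans with (norm (RtoC (r ^ N) *: p N)).
    - assert (e : p N = RtoC (/ r ^ N) *: (RtoC (r ^ N) *: p N)).
      { rewrite RtoC_inv by lra. cmodule. field. intros H. injection H. lra. }
      rewrite e at 1.
      apply Rle_trans with (r ^ N * (/ r ^ N * norm (RtoC (r ^ N) *: p N))).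
      + apply Rmult_le_compat_l; [lra|]. apply nrm_scal_R.
        left. apply Rinv_0_lt_compat. auto.
      + right. field. lra.
    - apply norm_le_of_cone_le; auto.
      apply (cone_eq (plus (minus (Bmu g) (S N)) (minus (S N) (RtoC (r ^ N) *: p N)))).
      + apply (cone_plus _ HK); auto.
        apply (cone_sum_minus (fun n => RtoC (r ^ n) *: p n)). auto.
      + cmodule. }
  destruct (linear_norm _ (proj1 HB)) as [M [HM HMb]].
  apply le_epsilon. intros eps Heps.
  (* After commuting [B] past the powers of [B1], the remainder is [c ^ (N + 1)] times [B (p N)].
     The bound on [p N] gives it norm at most [(Cmod c / r) ^ N * (Cmod c * M * norm (Bmu g))], a
     geometric sequence of ratio below 1. *)
  destruct (eventually_geom_lt (Cmod c / r) (Cmod c * M * norm (Bmu g)) eps) as [N HN]; auto.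
  { split; [apply Rdiv_le_0_compat; auto; apply Cmod_ge_0|].
    apply Rmult_lt_reg_r with r; auto. unfold Rdiv. rewrite Rmult_assoc, Rinv_l; lra. }
  { apply Rmult_le_pos; [|apply norm_ge_0]. apply Rmult_le_pos; [apply Cmod_ge_0|lra]. }
  specialize (HN N (Nat.le_refl N)).
  rewrite (resolvent_expansion A l1 la B1 B g N HB1 HB). fold c.
  apply Rle_trans with (1 := nrm_plus _ _). apply Rplus_le_compat.
  - apply Rle_trans with (2 * norm (S N)); [|specialize (HSn N); lra].
    apply (norm_sum_le p (fun n => r ^ n) (fun n => (c ^ n)%C)); auto.
    intros n. rewrite Cmod_pow. apply pow_incr. split; [apply Cmod_ge_0|lra].
  - left. apply Rle_lt_trans with (2 := HN). apply Rle_trans with (1 := nrm_scal _ _).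
    rewrite (resolvent_commute_iter A l1 la B1 B _ g HB1 HB). fold (p N).
    rewrite Cmod_pow.
    apply Rle_trans with (Cmod c ^ Datatypes.S N * (M * norm (p N))).
    { apply Rmult_le_compat_l; [apply pow_le, Cmod_ge_0|apply HMb]. }
    replace ((Cmod c / r) ^ N * (Cmod c * M * norm (Bmu g)))
      with (Cmod c ^ Datatypes.S N * (M * (norm (Bmu g) / r ^ N)))
      by (unfold Rdiv; rewrite Rpow_mult_distr, pow_inv; simpl; ring).
    apply Rmult_le_compat_l; [apply pow_le, Cmod_ge_0|].
    apply Rmult_le_compat_l; [lra|].
    apply Rmult_le_reg_l with (r ^ N); [apply pow_lt; auto|].
    apply Rle_trans with (1 := Hpn N). right. field. apply pow_nonzero. lra.
Qed.

End Cone.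

End ComplexBanach.

(** * Poles of the resolvent *)

Lemma at_right_0_intro (P : R -> Prop) (d : R) :
  0 < d -> (forall e, 0 < e < d -> P e) -> at_right 0 P.
Proof.
  intros Hd H. exists (mkposreal d Hd). intros e He Hpos. apply H. split; auto.
  unfold ball in He; simpl in He. unfold AbsRing_ball, abs, minus, plus, opp in He; simpl in He.
  apply Rabs_def2 in He. lra.
Qed.

Section Limits.

Context {E : CompleteNormedModule C_AbsRing} {T : Type} {F : (T -> Prop) -> Prop} {FF : Filter F}.

Lemma lim_plus (u v : T -> E) (x y : E) :
  filterlim u F (locally x) -> filterlim v F (locally y) ->
  filterlim (fun t => plus (u t) (v t)) F (locally (plus x y)).
Proof. intros Hu Hv. eapply filterlim_comp_2; [exact Hu|exact Hv|exact (filterlim_plus x y)]. Qed.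

Lemma lim_linear (L : E -> E) (u : T -> E) (x : E) :
  is_linear L -> filterlim u F (locally x) -> filterlim (fun t => L (u t)) F (locally (L x)).
Proof. intros HL Hu. exact (filterlim_comp _ _ _ u L _ _ _ Hu (linear_cont L x HL)). Qed.

Lemma linear_scal_C (c : C) : is_linear (fun x : E => c *: x).
Proof. apply (@is_linear_scal_r C_AbsRing E). intros a b. apply Cmult_comm. Qed.

Lemma lim_ext (u v : T -> E) (x : E) :
  (forall t, u t = v t) -> filterlim u F (locally x) -> filterlim v F (locally x).
Proof. apply filterlim_ext. Qed.

Lemma lim_norm_bounded (u : T -> E) (x : E) :
  filterlim u F (locally x) -> F (fun t => norm (u t) <= norm x + 1).
Proof.
  intros Hu. assert (H := proj1 (filterlim_norm_iff _ _) Hu 1 Rlt_0_1).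
  revert H. apply filter_imp. intros t Ht.
  apply Rle_trans with (1 := nrm_le_plus_minus (u t) x). lra.
Qed.

End Limits.

Section Poles.

Context {E : CompleteNormedModule C_AbsRing}.
Implicit Types (f g x y : E) (c la mu : C) (B : E -> E).

Lemma lim_pow_bounded (j : nat) (u : R -> E) (M : R) :
  (1 <= j)%nat -> at_right 0 (fun e => norm (u e) <= M) ->
  filterlim (fun e => RtoC (e ^ j) *: u e) (at_right 0) (locally (zero : E)).
Proof.
  intros Hj Hu. refine (proj2 (filterlim_norm_iff _ _) _). intros eps Heps.
  assert (HM : 0 < Rabs M + 1) by (assert (H := Rabs_pos M); lra).
  set (d := Rmin 1 (eps / (Rabs M + 1))).
  assert (Hd : 0 < d).
  { apply Rmin_glb_lt; [lra|]. apply Rdiv_lt_0_compat; auto. }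
  assert (Hs : at_right 0 (fun e => 0 < e < d)) by (apply (at_right_0_intro _ d); auto).
  generalize (filter_and _ _ Hu Hs). apply filter_imp. intros e [He1 He2].
  apply Rle_lt_trans with (norm (RtoC (e ^ j) *: u e)); [right; apply f_equal; cmodule|].
  assert (Hd1 : d <= 1) by apply Rmin_l.
  assert (Hd2 : d <= eps / (Rabs M + 1)) by apply Rmin_r.
  apply Rle_lt_trans with (e ^ j * norm (u e)); [apply nrm_scal_R; apply pow_le; lra|].
  assert (Hp : e ^ j <= e).
  { destruct j as [|j]; [lia|]. simpl.
    assert (0 <= e ^ j <= 1) by (split; [apply pow_le; lra|rewrite <- (pow1 j); apply pow_incr; lra]).
    nra. }
  apply Rle_lt_trans with (e * Rabs M).
  { apply Rmult_le_compat; auto; [apply pow_le; lra|apply norm_ge_0|].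
    apply Rle_trans with (1 := He1). apply Rle_abs. }
  apply Rlt_le_trans with (d * (Rabs M + 1)).
  { assert (H := Rabs_pos M). nra. }
  apply Rle_trans with (eps / (Rabs M + 1) * (Rabs M + 1)).
  - apply Rmult_le_compat_r; lra.
  - right. field. lra.
Qed.

(** A choice of resolvent as a function of the point, so that limits can be taken along it; off the
    resolvent set the value is arbitrary. *)
Definition resolvent_at (A : E -> E -> Prop) la : E -> E :=
  epsilon (inhabits (fun x => x)) (is_resolvent A la).

Lemma resolvent_atP (A : E -> E -> Prop) la :
  (exists B, is_resolvent A la B) -> is_resolvent A la (resolvent_at A la).
Proof. apply epsilon_spec. Qed.

(** The limit is pointwise and along [mu + e] with [e] decreasing to 0. For a point with real part
    [s(A)] this approach runs through the half plane in which positivity and domination hold. *)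
Definition leading_coefficient (A : E -> E -> Prop) mu (m : nat) (U : E -> E) : Prop :=
  at_right 0 (fun e => is_resolvent A (mu + RtoC e)%C (resolvent_at A (mu + RtoC e))) /\
  forall f, filterlim (fun e => RtoC (e ^ m) *: resolvent_at A (mu + RtoC e) f)
    (at_right 0) (locally (U f)).

(** A Cauchy-type estimate from convergence at one point: every term is a difference of two partial
    sums, and these are bounded. *)
Lemma power_series_terms_bounded (a : nat -> E) (t : R) l :
  0 < t -> is_series (fun n => RtoC (t ^ n) *: a n) l ->
  exists M, 0 <= M /\ forall n, norm (a n) <= M / t ^ n.
Proof.
  intros Ht Hs.
  destruct (filterlim_bounded (sum_n (fun n => RtoC (t ^ n) *: a n))) as [M HM].
  { exists l. exact Hs. }
  assert (HM0 : 0 <= M) by (apply Rle_trans with (2 := HM O); apply norm_ge_0).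
  exists (M + M). split; [lra|]. intros n.
  assert (Hp : 0 < t ^ n) by (apply pow_lt; auto).
  assert (Hn : norm (RtoC (t ^ n) *: a n) <= M + M).
  { destruct n as [|n].
    - assert (H := HM O). rewrite sum_O in H.
      apply Rle_trans with M; [exact H|lra].
    - assert (e : RtoC (t ^ S n) *: a (S n) = minus (sum_n (fun n => RtoC (t ^ n) *: a n) (S n))
                 (sum_n (fun n => RtoC (t ^ n) *: a n) n)) by (rewrite sum_Sn; cmodule).
      rewrite e. apply Rle_trans with (1 := nrm_minus _ _). apply Rplus_le_compat; apply HM. }
  assert (e : a n = RtoC (/ t ^ n) *: (RtoC (t ^ n) *: a n)).
  { rewrite RtoC_inv by lra. cmodule. field. intros H. injection H. lra. }
  rewrite e. assert (Hi : 0 < / t ^ n) by (apply Rinv_0_lt_compat; auto).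
  apply Rle_trans with (/ t ^ n * norm (RtoC (t ^ n) *: a n)); [apply nrm_scal_R; lra|].
  unfold Rdiv. rewrite Rmult_comm. apply Rmult_le_compat_r; lra.
Qed.

Lemma power_series_first_term (a : nat -> E) (M t e : R) l :
  0 <= M -> (forall n, norm (a n) <= M / t ^ n) -> 0 < e -> e <= t / 2 ->
  is_series (fun n => RtoC (e ^ n) *: a n) l ->
  norm (minus l (a O)) <= 2 * M * (e / t).
Proof.
  intros HM Ha He Het Hs.
  set (q := e / t). assert (Ht : 0 < t) by lra.
  assert (Hq0 : 0 < q) by (apply Rdiv_lt_0_compat; auto).
  assert (Hq : q <= 1 / 2).
  { apply Rmult_le_reg_r with t; auto. unfold q. replace (e / t * t) with e by (field; lra). lra. }
  (* The factor [1 - (1/2) ^ N] makes the induction close: the next term is at most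
     [q ^ (N+1) M <= M q (1/2) ^ N], which is exactly the increase of the bound. *)
  assert (Hsum : forall N, norm (minus (sum_n (fun n => RtoC (e ^ n) *: a n) N) (a O)) <=
     2 * M * q * (1 - (1/2) ^ N)).
  { induction N as [|N IH].
    - rewrite sum_O. apply Rle_trans with (norm (zero : E)); [right; apply f_equal; simpl; cmodule|].
      rewrite nrm_zero. simpl. lra.
    - rewrite sum_Sn.
      assert (e0 : minus (plus (sum_n (fun n => RtoC (e ^ n) *: a n) N) (RtoC (e ^ S N) *: a (S N)))
        (a O) = plus (minus (sum_n (fun n => RtoC (e ^ n) *: a n) N) (a O))
                     (RtoC (e ^ S N) *: a (S N))) by cmodule.
      rewrite e0. apply Rle_trans with (1 := nrm_plus _ _).
      assert (H1 : norm (RtoC (e ^ S N) *: a (S N)) <= q ^ S N * M).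
      { apply Rle_trans with (e ^ S N * norm (a (S N))); [apply nrm_scal_R, pow_le; lra|].
        apply Rle_trans with (e ^ S N * (M / t ^ S N)).
        - apply Rmult_le_compat_l; [apply pow_le; lra|auto].
        - right. unfold q, Rdiv. rewrite Rpow_mult_distr, pow_inv. ring. }
      assert (H2 : q ^ S N <= q * (1/2) ^ N).
      { simpl. apply Rmult_le_compat_l; [lra|]. apply pow_incr. lra. }
      assert (H3 : q ^ S N * M <= q * (1/2) ^ N * M) by (apply Rmult_le_compat_r; auto).
      simpl ((1/2) ^ S N). lra. }
  apply le_epsilon. intros eps Heps.
  assert (Hl := proj1 (filterlim_norm_iff _ _) Hs eps Heps).
  destruct Hl as [N HN].
  assert (HN' : norm (minus (sum_n (fun n => RtoC (e ^ n) *: a n) N) l) < eps)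
    by exact (HN N (Nat.le_refl N)).
  apply Rle_trans with (1 := nrm_minus_trans (sum_n (fun n => RtoC (e ^ n) *: a n) N) l (a O)).
  rewrite nrm_minus_sym. specialize (Hsum N).
  assert (0 <= (1/2) ^ N) by (apply pow_le; lra).
  assert (2 * M * q * (1 - (1/2) ^ N) <= 2 * M * q).
  { rewrite <- (Rmult_1_r (2 * M * q)) at 2. apply Rmult_le_compat_l; [|lra].
    apply Rmult_le_pos; lra. }
  apply Rle_trans with (eps + 2 * M * q); [|lra].
  apply Rplus_le_compat; [left; exact HN'|exact (Rle_trans _ _ _ Hsum H0)].
Qed.

(** Multiplying the Laurent series at [mu + e] by [e ^ m] turns it into a power series in [e] with
    constant term [U 0]; its value tends to that term as [e] tends to 0. *)
Lemma pole_leading_coefficient (A : E -> E -> Prop) mu m :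
  is_resolvent_pole A mu m ->
  (1 <= m)%nat /\
  exists U, is_linear U /\ (exists f, U f <> zero) /\ leading_coefficient A mu m U.
Proof.
  intros [Hm [r [U [HU [Hne Hr]]]]]. split; auto. exists (U O). split; auto. split; auto.
  assert (Hres : forall e, 0 < e < r -> exists B, is_resolvent A (mu + RtoC e)%C B /\
     forall f, is_series (fun n => RtoC (e ^ n) *: U n f) (RtoC (e ^ m) *: B f)).
  { intros e He.
    assert (Hd : (mu + RtoC e - mu)%C = RtoC e) by ring.
    destruct (Hr (mu + RtoC e)%C) as [B [HB Hc]].
    { rewrite Hd, Cmod_R, Rabs_pos_eq; lra. }
    exists B. split; auto. intros f. rewrite Hd in Hc.
    assert (Hser : is_series (fun n => (RtoC e ^ n / RtoC e ^ m) *: U n f) (B f)).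
    { refine (proj2 (filterlim_norm_iff _ _) _). intros eps Heps.
      assert (Hf := norm_ge_0 f).
      assert (Heps' : 0 < eps / (norm f + 1)) by (apply Rdiv_lt_0_compat; lra).
      specialize (Hc (mkposreal _ Heps')). revert Hc. apply filter_imp. intros N HN.
      apply Rle_lt_trans with (1 := HN f). simpl.
      apply Rmult_lt_reg_r with (norm f + 1); [lra|].
      replace (eps / (norm f + 1) * norm f * (norm f + 1)) with (eps * norm f) by (field; lra).
      nra. }
    apply (is_series_scal (RtoC (e ^ m) : C_AbsRing)) in Hser.
    revert Hser. apply is_series_ext. intros n.
    assert (Hnz : (RtoC e ^ m)%C <> 0) by (apply Cpow_nz; intros H; injection H; lra).
    rewrite !RtoC_pow. cmodule. field. exact Hnz. }
  assert (Hr' : at_right 0 (fun e => 0 < e < r)).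
  { apply (at_right_0_intro _ r); [apply cond_pos|auto]. }
  split.
  - revert Hr'. apply filter_imp. intros e He. apply resolvent_atP.
    destruct (Hres e He) as [B [HB _]]. eauto.
  - intros f. refine (proj2 (filterlim_norm_iff _ _) _). intros eps Heps.
    assert (Hrpos := cond_pos r). set (t := r / 2). assert (Ht : 0 < t < r) by (unfold t; lra).
    destruct (Hres t Ht) as [Bt [_ Hst]].
    destruct (power_series_terms_bounded (fun n => U n f) t _ (proj1 Ht) (Hst f)) as [M [HM Hb]].
    apply (at_right_0_intro _ (Rmin (t / 2) (eps * t / (2 * M + 1)))).
    { apply Rmin_glb_lt; [lra|]. apply Rdiv_lt_0_compat; [|lra]. apply Rmult_lt_0_compat; lra. }
    intros e [He Hlt].
    assert (He1 : e < t / 2) by (apply Rlt_le_trans with (1 := Hlt), Rmin_l).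
    assert (He2 : e < eps * t / (2 * M + 1)) by (apply Rlt_le_trans with (1 := Hlt), Rmin_r).
    assert (Her : 0 < e < r) by lra.
    destruct (Hres e Her) as [B [HB Hs]].
    assert (HB' : is_resolvent A (mu + RtoC e)%C (resolvent_at A (mu + RtoC e)))
      by (apply resolvent_atP; eauto).
    rewrite (resolvent_unique A _ _ _ f HB' HB).
    apply Rle_lt_trans with (2 * M * (e / t)).
    { apply (power_series_first_term (fun n => U n f) M t e); auto; lra. }
    apply Rmult_lt_reg_r with (t * (2 * M + 1)); [apply Rmult_lt_0_compat; lra|].
    replace (2 * M * (e / t) * (t * (2 * M + 1))) with (2 * M * (e * (2 * M + 1))) by (field; lra).
    assert (H : e * (2 * M + 1) < eps * t).
    { apply Rmult_lt_reg_r with (/ (2 * M + 1)); [apply Rinv_0_lt_compat; lra|].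
      replace (e * (2 * M + 1) * / (2 * M + 1)) with e by (field; lra). exact He2. }
    assert (0 < eps * t) by (apply Rmult_lt_0_compat; lra). nra.
Qed.

(** For [x = e ^ m R(mu + e) f] one has [A x = (mu + e) x - e ^ m f], and [e ^ m f] vanishes in the
    limit because [m >= 1]. The limit is taken in the closed form of this relation, written with one
    fixed resolvent [B0]. *)
Lemma leading_coefficient_eigen (A : E -> E -> Prop) mu m U f :
  (1 <= m)%nat -> leading_coefficient A mu m U -> A (U f) (mu *: U f).
Proof.
  intros Hm [Hres Hlim].
  destruct (filter_ex _ Hres) as [e0 H0].
  set (la := (mu + RtoC e0)%C) in *. set (B0 := resolvent_at A la) in *.
  apply (graph_iff_resolvent A la B0); auto.
  assert (HB0 := proj1 H0).
  apply (@filterlim_locally_unique R C_AbsRing E (at_right 0) _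
    (fun e => RtoC (e ^ m) *: resolvent_at A (mu + RtoC e) f)); [exact (Hlim f)|].
  set (x := fun e => RtoC (e ^ m) *: resolvent_at A (mu + RtoC e) f).
  assert (Hx : filterlim x (at_right 0) (locally (U f))) by exact (Hlim f).
  assert (H1 : filterlim (fun e => B0 (plus (plus (RtoC (e ^ m) *: f) (RtoC (e ^ 1) *: ((- (1)) *: x e)))
       ((la - mu) *: x e))) (at_right 0) (locally (B0 (plus (plus zero zero) ((la - mu) *: U f))))).
  { apply lim_linear; auto. apply lim_plus; [apply lim_plus|].
    - apply (lim_pow_bounded m (fun _ => f) (norm f)); auto.
      apply (at_right_0_intro _ 1); [lra|]. intros; lra.
    - apply (lim_pow_bounded 1 _ (norm ((- (1)) *: U f) + 1)); auto.
      apply lim_norm_bounded. apply (lim_linear (fun y => (- (1)) *: y)); auto.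
      apply linear_scal_C.
    - apply (lim_linear (fun y => (la - mu) *: y)); auto. apply linear_scal_C. }
  assert (e : minus (la *: U f) (mu *: U f) = plus (plus zero zero) ((la - mu) *: U f)) by cmodule.
  rewrite e.
  refine (filterlim_ext_loc _ _ _ H1). revert Hres. apply filter_imp. intros d Hd.
  set (Bd := resolvent_at A (mu + RtoC d)) in *.
  assert (Hid := resolvent_identity A la _ B0 Bd f H0 Hd).
  rewrite <- (linear_scal _ HB0), <- (linear_plus _ HB0) in Hid.
  unfold x. fold Bd. rewrite Hid at 3. rewrite <- (linear_scal _ HB0). f_equal.
  rewrite pow_1. cmodule.
Qed.

(** An operator that maps the graph of [A] into itself commutes with every resolvent, hence with
    their limits. *)
Lemma leading_coefficient_commute (A : E -> E -> Prop) mu m U L f :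
  leading_coefficient A mu m U -> is_linear L ->
  (forall x y, A x y -> A (L x) (L y)) -> U (L f) = L (U f).
Proof.
  intros [Hres Hlim] HL HA.
  apply (@filterlim_locally_unique R C_AbsRing E (at_right 0) _
    (fun e => RtoC (e ^ m) *: resolvent_at A (mu + RtoC e) (L f))); [exact (Hlim (L f))|].
  refine (filterlim_ext_loc _ _ _ (lim_linear L _ _ HL (Hlim f))).
  revert Hres. apply filter_imp. intros e [_ [H1 H2]].
  rewrite (linear_scal _ HL). f_equal.
  destruct (H1 f) as [g [Hg He]]. apply HA in Hg. apply H2 in Hg.
  rewrite <- Hg. f_equal.
  rewrite <- He at 2. rewrite (linear_minus _ _ _ HL), (linear_scal _ HL). reflexivity.
Qed.

End Poles.

(** * Local boundedness of semigroups *)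

Section UniformBoundedness.

Context {E : CompleteNormedModule C_AbsRing}.

Lemma nrm_scal_R_eq (a : R) (x : E) : 0 < a -> norm (RtoC a *: x) = a * norm x.
Proof.
  intros Ha. apply Rle_antisym; [apply nrm_scal_R; lra|].
  assert (Hi : 0 < / a) by (apply Rinv_0_lt_compat; auto).
  assert (e : x = RtoC (/ a) *: (RtoC a *: x)).
  { rewrite RtoC_inv by lra. cmodule. field. intros H. injection H. lra. }
  rewrite e at 1. apply Rle_trans with (a * (/ a * norm (RtoC a *: x))).
  - apply Rmult_le_compat_l; [lra|]. apply nrm_scal_R. lra.
  - right. field. lra.
Qed.

Variable L : nat -> E -> E.
Hypothesis HL : forall n, is_linear (L n).

(** Some [h] of norm [r] has [norm (L n h) > k + 1]. As [2 L h = L (x + h) - L (x - h)], one of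
    [x + h] and [x - h] has an image just as large. The new radius is so small that [L n] varies by
    at most 1 on the doubled ball, which leaves more than [k]. *)
Lemma unbounded_near (x : E) (r k : R) :
  ~ (exists M, 0 < M /\ forall n f, norm (L n f) <= M * norm f) -> 0 < r -> 0 <= k ->
  exists (x' : E) (r' : R), norm (minus x' x) <= r /\ 0 < r' <= r / 2 /\
    forall y, norm (minus y x') <= 2 * r' -> exists n, k < norm (L n y).
Proof.
  intros Hno Hr Hk.
  set (M := (k + 1) / r). assert (HM : 0 < M) by (apply Rdiv_lt_0_compat; lra).
  assert (Hnf : exists n f, M * norm f < norm (L n f)).
  { apply NNPP. intros H. apply Hno. exists M. split; auto. intros n f.
    apply Rnot_lt_le. intros Hlt. apply H. eauto. }
  destruct Hnf as [n [f Hf]].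
  destruct (linear_norm _ (HL n)) as [Cn [HCn Hb]].
  assert (Hfpos : 0 < norm f).
  { destruct (norm_ge_0 f) as [H|H]; auto. exfalso.
    specialize (Hb f). rewrite <- H in Hb, Hf. lra. }
  set (a := r / norm f). assert (Ha : 0 < a) by (apply Rdiv_lt_0_compat; auto).
  set (h := RtoC a *: f).
  assert (Hh : norm h = r).
  { unfold h. rewrite nrm_scal_R_eq by auto. unfold a. field. lra. }
  assert (HLh : k + 1 < norm (L n h)).
  { unfold h. rewrite (linear_scal _ (HL n)).
    rewrite nrm_scal_R_eq by auto.
    apply Rle_lt_trans with (a * (M * norm f)).
    - right. unfold a, M. field. lra.
    - apply Rmult_lt_compat_l; auto. }
  assert (Hx' : exists x', norm (minus x' x) <= r /\ k + 1 < norm (L n x')).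
  { apply NNPP. intros Hn.
    assert (H1 : norm (L n (plus x h)) <= k + 1).
    { apply Rnot_lt_le. intros H. apply Hn. exists (plus x h). split; auto.
      apply Rle_trans with (norm h); [right; apply f_equal; cmodule|lra]. }
    assert (H2 : norm (L n (minus x h)) <= k + 1).
    { apply Rnot_lt_le. intros H. apply Hn. exists (minus x h). split; auto.
      apply Rle_trans with (norm h); [right; rewrite <- nrm_opp; apply f_equal; cmodule|lra]. }
    assert (e : RtoC 2 *: L n h = minus (L n (plus x h)) (L n (minus x h))).
    { rewrite (linear_plus _ (HL n)), (linear_minus _ _ _ (HL n)). cmodule. }
    assert (H3 : norm (RtoC 2 *: L n h) = 2 * norm (L n h)) by (apply nrm_scal_R_eq; lra).
    rewrite e in H3.
    assert (H4 := nrm_minus (L n (plus x h)) (L n (minus x h))). lra. }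
  destruct Hx' as [x' [Hx'1 Hx'2]].
  exists x', (Rmin (r / 2) (/ (2 * Cn))). split; auto. split.
  { split; [|apply Rmin_l]. apply Rmin_glb_lt; [lra|]. apply Rinv_0_lt_compat. lra. }
  intros y Hy. exists n.
  assert (H1 := nrm_le_plus_minus (L n x') (L n y)).
  assert (H2 : norm (minus (L n x') (L n y)) <= 1).
  { rewrite nrm_minus_sym.
    assert (e : minus (L n y) (L n x') = L n (minus y x')).
    { symmetry. apply (linear_minus _ _ _ (HL n)). }
    rewrite e. apply Rle_trans with (1 := Hb _).
    assert (Hr2 := Rmin_r (r / 2) (/ (2 * Cn))).
    apply Rle_trans with (Cn * (2 * / (2 * Cn))).
    - apply Rmult_le_compat_l; lra.
    - right. field. lra. }
  lra.
Qed.

(* Gliding hump, in the form of nested balls. *)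
Theorem uniform_boundedness :
  (forall f, exists M, forall n, norm (L n f) <= M) ->
  exists M, 0 < M /\ forall n f, norm (L n f) <= M * norm f.
Proof.
  intros Hpt. apply NNPP. intros Hno.
  (* Guarding by positivity of the radius makes the step total, so that choice yields a function
     which can be iterated. *)
  assert (Hs : forall p : E * R * nat, exists q : E * R, 0 < snd (fst p) ->
    norm (minus (fst q) (fst (fst p))) <= snd (fst p) /\ 0 < snd q <= snd (fst p) / 2 /\
    forall y, norm (minus y (fst q)) <= 2 * snd q -> exists n, INR (snd p) < norm (L n y)).
  { intros [[x r] k]. simpl. destruct (Rlt_dec 0 r) as [Hr|Hr].
    - destruct (unbounded_near x r (INR k) Hno Hr (pos_INR k)) as [x' [r' H]].
      exists (x', r'). intros _. exact H.
    - exists (x, r). intros H. contradiction. }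
  set (Fs := fun p => proj1_sig (constructive_indefinite_description _ (Hs p))).
  assert (HF : forall p, 0 < snd (fst p) ->
    norm (minus (fst (Fs p)) (fst (fst p))) <= snd (fst p) /\ 0 < snd (Fs p) <= snd (fst p) / 2 /\
    forall y, norm (minus y (fst (Fs p))) <= 2 * snd (Fs p) -> exists n, INR (snd p) < norm (L n y)).
  { intros p. unfold Fs. destruct (constructive_indefinite_description _ (Hs p)) as [q Hq]. exact Hq. }
  clearbody Fs. clear Hs.
  set (s := fix s (k : nat) : E * R := match k with O => (zero : E, 1) | S k' => Fs (s k', k') end).
  set (x := fun k => fst (s k)). set (r := fun k => snd (s k)).
  assert (Hr : forall k, 0 < r k).
  { induction k as [|k IH]; [unfold r; simpl; lra|]. apply (HF (s k, k) IH). }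
  assert (HxS : forall k, norm (minus (x (S k)) (x k)) <= r k).
  { intros k. apply (HF (s k, k) (Hr k)). }
  assert (HrS : forall k, r (S k) <= r k / 2).
  { intros k. apply (HF (s k, k) (Hr k)). }
  assert (Hbig : forall k y, norm (minus y (x (S k))) <= 2 * r (S k) ->
     exists n, INR k < norm (L n y)).
  { intros k. apply (HF (s k, k) (Hr k)). }
  clearbody x r.
  assert (Hgeo : forall k, r k <= r O * (1/2) ^ k).
  { induction k as [|k IH]; simpl; [lra|]. specialize (HrS k). lra. }
  set (a := fun k => minus (x (S k)) (x k)).
  assert (Hex : ex_series a).
  { apply (@ex_series_le C_AbsRing E a (fun k => r O * (1/2) ^ k)).
    - intros k. apply Rle_trans with (2 := Hgeo k). apply HxS.
    - apply (@ex_series_scal R_AbsRing R_NormedModule (r O)). apply ex_series_geom.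
      rewrite Rabs_pos_eq; lra. }
  destruct Hex as [l Hl].
  assert (Hsum : forall N, sum_n a N = minus (x (S N)) (x O)).
  { induction N as [|N IH]; [apply sum_O|]. rewrite sum_Sn, IH. unfold a. cmodule. }
  assert (Hzdef : exists z : E, z = plus l (x O)) by eauto.
  destruct Hzdef as [z Hzdef].
  assert (Hlim : forall eps, 0 < eps -> exists N, forall n, (N <= n)%nat ->
    norm (minus z (x (S n))) < eps).
  { intros eps Heps. destruct (proj1 (filterlim_norm_iff _ _) Hl eps Heps) as [N HN].
    exists N. intros n Hn. specialize (HN n Hn). rewrite nrm_minus_sym.
    apply Rle_lt_trans with (2 := HN). right. apply f_equal.
    rewrite Hsum, Hzdef. cmodule. }
  (* Halving radii satisfy [r k <= 2 (r k - r (k+1))], so the distances telescope. The limit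
     therefore lies within [2 r k] of [x k], which explains the doubled balls of
     [unbounded_near]. *)
  assert (Htail : forall k j, norm (minus (x (k + j)%nat) (x k)) <= 2 * (r k - r (k + j)%nat)).
  { intros k. induction j as [|j IH].
    - rewrite Nat.add_0_r. apply Rle_trans with (norm (zero : E)); [right; apply f_equal; cmodule|].
      rewrite nrm_zero. lra.
    - rewrite Nat.add_succ_r. assert (H1 := HxS (k + j)%nat). assert (H2 := HrS (k + j)%nat).
      assert (H3 := nrm_minus_trans (x (k + j)%nat) (x (S (k + j))) (x k)). lra. }
  assert (Hz : forall k, norm (minus z (x k)) <= 2 * r k).
  { intros k. apply le_epsilon. intros eps Heps. destruct (Hlim eps Heps) as [N HN].
    specialize (HN (k + N)%nat ltac:(lia)).
    assert (H1 := Htail k (S N)). rewrite Nat.add_succ_r in H1.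
    assert (H2 := nrm_minus_trans (x (S (k + N))) z (x k)). assert (H3 := Hr (S (k + N))). lra. }
  destruct (Hpt z) as [M HM]. destruct (INR_unbounded M) as [k Hk].
  destruct (Hbig k z (Hz (S k))) as [n Hn]. specialize (HM n). lra.
Qed.

End UniformBoundedness.

Section Semigroup.

Context {E : CompleteNormedModule C_AbsRing} (T : R -> E -> E) (hT : C0_semigroup T).

Lemma semigroup_right_cont_0 f eps :
  0 < eps -> exists d, 0 < d /\ forall t, 0 <= t < d -> norm (minus (T t f) f) < eps.
Proof.
  intros Heps. destruct (proj1 (filterlim_norm_iff _ _) (c0_cont _ hT f) eps Heps) as [d Hd].
  exists d. split; [apply cond_pos|]. intros t Ht. destruct (proj1 Ht) as [H|<-].
  - apply Hd; auto. unfold ball; simpl. unfold AbsRing_ball, abs, minus, plus, opp; simpl.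
    apply Rabs_def1; lra.
  - rewrite (c0_zero _ hT). apply Rle_lt_trans with (norm (zero : E)).
    + right. apply f_equal. cmodule.
    + rewrite nrm_zero. exact Heps.
Qed.

(** Otherwise there are times [t n <= 1/(n+1)] at which the norm of [T (t n)] exceeds [n + 1].
    Strong continuity at 0 makes these operators pointwise bounded, against the uniform boundedness
    principle. *)
Lemma semigroup_bounded_near_0 :
  exists d M, 0 < d /\ 1 <= M /\ forall t f, 0 <= t <= d -> norm (T t f) <= M * norm f.
Proof.
  apply NNPP. intros Hno.
  assert (Hn : forall n, exists t, 0 <= t <= / INR (S n) /\ exists f, INR (S n) * norm f < norm (T t f)).
  { intros n. apply NNPP. intros H. apply Hno.
    assert (HS : 0 < INR (S n)) by (apply lt_0_INR; lia).
    exists (/ INR (S n)), (INR (S n)). split; [apply Rinv_0_lt_compat; auto|].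
    split; [change 1 with (INR 1); apply le_INR; lia|].
    intros t f Ht. apply Rnot_lt_le. intros Hlt. apply H. eauto. }
  set (t := fun n => proj1_sig (constructive_indefinite_description _ (Hn n))).
  assert (Ht : forall n, 0 <= t n <= / INR (S n) /\ exists f, INR (S n) * norm f < norm (T (t n) f)).
  { intros n. unfold t. destruct (constructive_indefinite_description _ (Hn n)); auto. }
  clearbody t.
  destruct (uniform_boundedness (fun n => T (t n))) as [M [HM Hb]].
  - intros n. apply (c0_bounded _ hT). apply Ht.
  - intros f. destruct (filterlim_bounded (fun n => T (t n) f)) as [M HM]; [|eauto].
    exists f. refine (proj2 (filterlim_norm_iff _ _) _). intros eps Heps.
    destruct (semigroup_right_cont_0 f eps Heps) as [d [Hd Hdd]].
    destruct (INR_unbounded (/ d)) as [N HN]. exists N. intros n Hle. apply Hdd.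
    destruct (Ht n) as [[H1 H2] _]. split; auto. apply Rle_lt_trans with (1 := H2).
    rewrite <- (Rinv_inv d).
    assert (Hdi : 0 < / d) by (apply Rinv_0_lt_compat; auto).
    assert (HNn : INR N <= INR (S n)) by (apply le_INR; lia).
    apply Rinv_lt_contravar; [|lra]. apply Rmult_lt_0_compat; lra.
  - destruct (INR_unbounded M) as [n Hn']. destruct (Ht n) as [_ [f Hf]].
    specialize (Hb n f). rewrite S_INR in Hf. assert (H := norm_ge_0 f).
    assert (M * norm f <= (INR n + 1) * norm f) by (apply Rmult_le_compat_r; lra). lra.
Qed.

Lemma semigroup_locally_bounded (a : R) :
  exists M, 1 <= M /\ forall t f, 0 <= t <= a -> norm (T t f) <= M * norm f.
Proof.
  destruct semigroup_bounded_near_0 as [d [M [Hd [HM Hb]]]].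
  assert (Hn : forall n, exists M', 1 <= M' /\
     forall t f, 0 <= t <= INR n * d -> norm (T t f) <= M' * norm f).
  { induction n as [|n [M' [HM' IH]]].
    - exists 1. split; [lra|]. intros t f Ht. simpl in Ht. replace t with 0 by lra.
      rewrite (c0_zero _ hT). lra.
    - exists (M * M'). split; [nra|]. intros t f Ht. rewrite S_INR in Ht.
      assert (Hf := norm_ge_0 f).
      destruct (Rle_dec t (INR n * d)) as [Hle|Hgt].
      + apply Rle_trans with (1 := IH t f (conj (proj1 Ht) Hle)).
        apply Rmult_le_compat_r; auto. nra.
      + assert (Hnd : 0 <= INR n * d) by (apply Rmult_le_pos; [apply pos_INR|lra]).
        replace t with ((t - INR n * d) + INR n * d) by ring.
        rewrite (c0_plus _ hT) by lra.
        apply Rle_trans with (1 := Hb (t - INR n * d) _ ltac:(lra)).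
        rewrite Rmult_assoc. apply Rmult_le_compat_l; [lra|]. apply IH. lra. }
  destruct (INR_unbounded (a / d)) as [n Hna]. destruct (Hn n) as [M' [HM' H]].
  exists M'. split; auto. intros t f Ht. apply H. split; [lra|].
  assert (a < INR n * d).
  { apply Rmult_lt_reg_r with (/ d); [apply Rinv_0_lt_compat; auto|].
    replace (INR n * d * / d) with (INR n) by (field; lra). exact Hna. }
  lra.
Qed.

(** Extended by the constant [f] to negative times, so that it is continuous on the whole line and
    two-sided continuity can be used at 0 as well. *)
Definition orbit (f : E) (r : R) : E := T (Rmax 0 r) f.

Lemma orbit_eq f r : 0 <= r -> orbit f r = T r f.
Proof. intros H. unfold orbit. rewrite Rmax_right; auto. Qed.

Lemma orbit_continuous f r : continuous (orbit f) r.
Proof.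
  refine (proj2 (filterlim_norm_iff (orbit f) _) _). intros eps Heps.
  destruct (semigroup_locally_bounded (Rmax 0 r + 1)) as [M [HM Hb]].
  destruct (semigroup_right_cont_0 f (eps / M)) as [d [Hd Hdd]]; [apply Rdiv_lt_0_compat; lra|].
  assert (Hd1 : 0 < Rmin d 1) by (apply Rmin_glb_lt; lra).
  (* Factoring out the earlier time, [T b - T a = T a (T (b - a) - I)]. Approaching [r] from the
     left, the base point [a] moves, which is why a bound uniform in [a] is required. *)
  assert (Hmono : forall a b, 0 <= a <= b -> a <= Rmax 0 r + 1 -> b - a < d ->
     norm (minus (T b f) (T a f)) < eps).
  { intros a b Hab Ha Hlt. assert (e : b = a + (b - a)) by ring.
    rewrite e at 1. rewrite (c0_plus _ hT) by lra.
    apply Rle_lt_trans with (norm (T a (minus (T (b - a) f) f))).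
    - right. apply f_equal. symmetry.
      apply (linear_minus (T a)). apply (c0_bounded _ hT). lra.
    - apply Rle_lt_trans with (1 := Hb a _ ltac:(lra)).
      assert (H := Hdd (b - a) ltac:(lra)).
      apply Rmult_lt_compat_l with (r := M) in H; [|lra].
      replace (M * (eps / M)) with eps in H by (field; lra). exact H. }
  exists (mkposreal _ Hd1). intros r' Hr'.
  unfold ball in Hr'; simpl in Hr'. unfold AbsRing_ball, abs, minus, plus, opp in Hr'; simpl in Hr'.
  assert (Hd2 := Rmin_l d 1). assert (Hd3 := Rmin_r d 1).
  apply Rabs_def2 in Hr'. unfold orbit.
  destruct (Rle_dec r r') as [Hle|Hgt].
  - apply Hmono; unfold Rmax; repeat destruct (Rle_dec _ _); lra.
  - rewrite nrm_minus_sym.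
    apply Hmono; unfold Rmax; repeat destruct (Rle_dec _ _); lra.
Qed.

Lemma generator_commutes t x y : 0 <= t -> generator T x y -> generator T (T t x) (T t y).
Proof.
  intros Ht H. unfold generator in *.
  assert (Hlin := c0_bounded _ hT t Ht).
  refine (filterlim_ext_loc _ _ _ (lim_linear (T t) _ _ Hlin H)).
  apply (at_right_0_intro _ 1); [lra|]. intros e He.
  rewrite (linear_scal _ Hlin). f_equal. rewrite (linear_minus _ _ _ Hlin).
  rewrite <- !(c0_plus _ hT) by lra. rewrite Rplus_comm. reflexivity.
Qed.

End Semigroup.

(** * Integration of orbits *)

Section Realification.

Variable E : CompleteNormedModule C_AbsRing.

Let cls : CompleteNormedModule.class_of C_AbsRing E := CompleteNormedModule.class C_AbsRing E.

Let group_cls : AbelianGroup.class_of E :=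
  ModuleSpace.base _ _ (NormedModuleAux.base _ _ (NormedModule.base _ _
    (CompleteNormedModule.base _ _ cls))).

Let unif : UniformSpace.mixin_of E :=
  NormedModuleAux.mixin _ _ (NormedModule.base _ _ (CompleteNormedModule.base _ _ cls)).

Definition real_scal (a : R) (x : E) : E := RtoC a *: x.

Lemma real_scal_assoc (a b : R) (x : E) :
  real_scal a (real_scal b x) = real_scal (a * b) x.
Proof. unfold real_scal. rewrite RtoC_mult. cmodule. Qed.

Lemma real_scal_one (x : E) : real_scal 1 x = x.
Proof. unfold real_scal. cmodule. Qed.

Lemma real_scal_distr_l (a : R) (x y : E) :
  real_scal a (plus x y) = plus (real_scal a x) (real_scal a y).
Proof. unfold real_scal. cmodule. Qed.

Lemma real_scal_distr_r (a b : R) (x : E) :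
  real_scal (a + b) x = plus (real_scal a x) (real_scal b x).
Proof. unfold real_scal. rewrite RtoC_plus. cmodule. Qed.

Lemma norm_real_scal (a : R) (x : E) : norm (real_scal a x) <= Rabs a * norm x.
Proof. rewrite <- Cmod_R. apply nrm_scal. Qed.

Lemma real_norm_triangle (x y : E) : norm (plus x y) <= norm x + norm y.
Proof. exact (nrm_plus x y). Qed.

Lemma real_norm_compat1 (x y : E) (eps : R) : norm (minus y x) < eps -> ball x eps y.
Proof. exact (@norm_compat1 C_AbsRing E x y eps). Qed.

Lemma real_norm_compat2 (x y : E) (eps : posreal) :
  ball x eps y -> norm (minus y x) < @norm_factor C_AbsRing E * eps.
Proof. exact (@norm_compat2 C_AbsRing E x y eps). Qed.

Lemma real_norm_eq_zero (x : E) : norm x = 0 -> x = zero.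
Proof. exact (@norm_eq_zero C_AbsRing E x). Qed.

Definition real_module_class : ModuleSpace.class_of R_Ring E :=
  ModuleSpace.Class R_Ring E group_cls
    (ModuleSpace.Mixin R_Ring (AbelianGroup.Pack E group_cls E) real_scal
       real_scal_assoc real_scal_one real_scal_distr_l real_scal_distr_r).

Definition real_aux_class : NormedModuleAux.class_of R_AbsRing E :=
  NormedModuleAux.Class R_AbsRing E real_module_class unif.

Definition real_normed_class : NormedModule.class_of R_AbsRing E :=
  NormedModule.Class R_AbsRing E real_aux_class
    (NormedModule.Mixin R_AbsRing (NormedModuleAux.Pack R_AbsRing E real_aux_class E)
       (@norm C_AbsRing E) (@norm_factor C_AbsRing E)
       real_norm_triangle norm_real_scal real_norm_compat1 real_norm_compat2 real_norm_eq_zero).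

(** Restriction of scalars, giving access to the Riemann integral with values in real modules.
    Addition, norm and uniform structure are those of [E], so continuity and limits agree by
    conversion. *)
Definition realify : CompleteNormedModule R_AbsRing :=
  CompleteNormedModule.Pack R_AbsRing E
    (CompleteNormedModule.Class R_AbsRing E real_normed_class (CompleteNormedModule.mixin _ _ cls)) E.

End Realification.

Section Integral.

Context {E : CompleteNormedModule C_AbsRing}.
Implicit Types (u v : R -> E) (a b : R).

Definition integral u a b : E := @RInt (realify E) u a b.

Lemma integral_correct u a b :
  (forall r, continuous u r) -> @is_RInt (realify E) u a b (integral u a b).
Proof.
  intros Hu. apply (@RInt_correct (realify E)).
  apply (@ex_RInt_continuous (realify E)). intros r _. exact (Hu r).
Qed.

Lemma integral_chasles u a b c :
  (forall r, continuous u r) -> plus (integral u a b) (integral u b c) = integral u a c.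
Proof.
  intros Hu. apply (@RInt_Chasles (realify E));
    [exists (integral u a b)|exists (integral u b c)]; apply integral_correct; auto.
Qed.

Lemma integral_ext u v a b :
  a <= b -> (forall r, a < r < b -> u r = v r) -> integral u a b = integral v a b.
Proof.
  intros Hab H. apply (@RInt_ext (realify E)). intros r.
  rewrite Rmin_left, Rmax_right by auto. apply H.
Qed.

Lemma integral_shift u (h t : R) :
  (forall r, continuous u r) -> integral (fun r => u (r + h)) 0 t = integral u h (t + h).
Proof.
  intros Hu. apply (@is_RInt_unique (realify E)).
  assert (H : @is_RInt (realify E) u (1 * 0 + h) (1 * t + h) (integral u h (t + h))).
  { rewrite Rmult_0_r, Rplus_0_l, Rmult_1_l. apply integral_correct. exact Hu. }
  apply (@is_RInt_comp_lin (realify E)) in H.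
  refine (@is_RInt_ext (realify E) _ _ _ _ _ _ H).
  intros r _. rewrite Rmult_1_l. apply (@scal_one R_Ring (realify E)).
Qed.

Lemma Riemann_sum_linear (L : E -> E) u ptd :
  is_linear L ->
  @Riemann_sum (realify E) (fun r => L (u r)) ptd = L (@Riemann_sum (realify E) u ptd).
Proof.
  intros HL. induction ptd as [x0|h s IH] using SF_cons_ind.
  - symmetry. exact (linear_zero L HL).
  - rewrite !(@Riemann_sum_cons (realify E)), IH.
    symmetry. etransitivity; [apply (linear_plus _ HL)|].
    apply (f_equal2 (@plus E)); [apply (linear_scal _ HL)|reflexivity].
Qed.

Lemma integral_linear (L : E -> E) u a b :
  is_linear L -> (forall r, continuous u r) ->
  integral (fun r => L (u r)) a b = L (integral u a b).
Proof.
  intros HL Hu. apply (@is_RInt_unique (realify E)).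
  assert (H := lim_linear L _ _ HL (integral_correct u a b Hu)).
  refine (filterlim_ext _ _ _ H). intros ptd. rewrite Riemann_sum_linear by auto.
  apply (linear_scal _ HL).
Qed.

Lemma integral_plus u v a b :
  (forall r, continuous u r) -> (forall r, continuous v r) ->
  integral (fun r => plus (u r) (v r)) a b = plus (integral u a b) (integral v a b).
Proof.
  intros Hu Hv. apply (@is_RInt_unique (realify E)).
  apply (@is_RInt_plus (realify E)); apply integral_correct; auto.
Qed.

Lemma integral_norm_le u a b M :
  (forall r, continuous u r) -> a <= b -> (forall r, a <= r <= b -> norm (u r) <= M) ->
  norm (integral u a b) <= (b - a) * M.
Proof.
  intros Hu Hab Hb.
  exact (@norm_RInt_le_const (realify E) u a b _ M Hab Hb (integral_correct u a b Hu)).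
Qed.

Lemma integral_difference_quotient u a :
  (forall r, continuous u r) ->
  filterlim (fun h => RtoC (/ h) *: integral u a (a + h)) (at_right 0) (locally (u a)).
Proof.
  intros Hu. refine (proj2 (filterlim_norm_iff _ _) _). intros eps Heps.
  destruct (proj1 (filterlim_norm_iff _ _) (Hu a) (eps / 2) ltac:(lra)) as [d Hd].
  apply (at_right_0_intro _ d); [apply cond_pos|]. intros h Hh.
  assert (Hi := integral_correct u a (a + h) Hu).
  assert (Hm := @is_RInt_minus (realify E) _ _ _ _ _ _ Hi
    (@is_RInt_const (realify E) a (a + h) (u a))).
  assert (Hn : norm (minus (integral u a (a + h)) (RtoC (a + h - a) *: u a)) <=
      (a + h - a) * (eps / 2)).
  { refine (@norm_RInt_le_const (realify E) _ a (a + h) _ (eps / 2) _ _ Hm); [lra|].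
    intros r Hr. destruct (Req_dec r a) as [->|Hne].
    - apply Rle_trans with (norm (zero : E)); [right; apply (f_equal (@norm C_AbsRing E)); cmodule|].
      rewrite nrm_zero. lra.
    - left. apply Hd. unfold ball; simpl. unfold AbsRing_ball, abs, minus, plus, opp; simpl.
      apply Rabs_def1; lra. }
  replace (a + h - a) with h in Hn by ring.
  assert (Hih : 0 < / h) by (apply Rinv_0_lt_compat; lra).
  apply Rle_lt_trans with
    (norm (RtoC (/ h) *: minus (integral u a (a + h)) (RtoC h *: u a))).
  - right. apply f_equal. rewrite RtoC_inv by lra. cmodule. field.
    intros H. injection H. lra.
  - apply Rle_lt_trans with (1 := nrm_scal_R _ _ (Rlt_le _ _ Hih)).
    apply Rle_lt_trans with (/ h * (h * (eps / 2))).
    + apply Rmult_le_compat_l; lra.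
    + replace (/ h * (h * (eps / 2))) with (eps / 2) by (field; lra). lra.
Qed.

Lemma Riemann_sum_cone (K : E -> Prop) u ptd :
  closed_cone K -> (forall r, K (u r)) -> pointed_subdiv ptd ->
  K (@Riemann_sum (realify E) u ptd).
Proof.
  intros HK Hu. induction ptd as [x0|h s IH] using SF_cons_ind; intros Hp.
  - apply (cone_zero _ HK).
  - rewrite (@Riemann_sum_cons (realify E)).
    apply (cone_plus _ HK).
    + apply (cone_scal _ HK); auto.
      assert (H : fst h <= snd h <= SF_h s) by (apply (Hp O), Nat.lt_0_succ). lra.
    + apply IH. apply (ptd_cons h). exact Hp.
Qed.

Lemma integral_cone (K : E -> Prop) u a b :
  closed_cone K -> a <= b -> (forall r, continuous u r) -> (forall r, K (u r)) ->
  K (integral u a b).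
Proof.
  intros HK Hab Hu Hk.
  (* The integral is the limit of Riemann sums multiplied by [sign (b - a)], so this factor must be
     seen to keep them in the cone. *)
  assert (Hs : 0 <= sign (b - a)).
  { destruct (Req_dec a b) as [->|Hne].
    - rewrite Rminus_diag, sign_0. lra.
    - rewrite sign_eq_1; lra. }
  apply (cone_closed _ HK). intros Hloc.
  assert (HF := integral_correct u a b Hu _ Hloc).
  destruct (@filter_ex _ _ (Riemann_fine_filter a b) _ HF) as [ptd Hptd].
  assert (Hp : Riemann_fine a b (fun ptd => pointed_subdiv ptd)).
  { unfold Riemann_fine, within. apply filter_forall. intros p H. apply H. }
  destruct (@filter_ex _ _ (Riemann_fine_filter a b) _
    (@filter_and _ _ (@filter_filter _ _ (Riemann_fine_filter a b)) _ _ HF Hp)) as [p [H1 H2]].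
  apply H1. apply (cone_scal _ HK); auto. apply Riemann_sum_cone; auto.
Qed.

End Integral.

(** * The integrated semigroup and the resolvent built from it *)

Section IntegratedSemigroup.

Context {E : CompleteNormedModule C_AbsRing} (T : R -> E -> E) (hT : C0_semigroup T).

Definition integrated (t : R) (f : E) : E := integral (orbit T f) 0 t.

Lemma integrated_linear t : 0 <= t -> is_linear (integrated t).
Proof.
  intros Ht. split.
  - intros f g. unfold integrated.
    etransitivity; [|apply integral_plus; apply (orbit_continuous T hT)].
    apply integral_ext; auto. intros r _.
    apply (linear_plus (T (Rmax 0 r))). apply (c0_bounded _ hT), Rmax_l.
  - intros c f. unfold integrated.
    etransitivity; [|apply (integral_linear (fun x => scal c x));
      [apply linear_scal_C|apply (orbit_continuous T hT)]].
    apply integral_ext; auto. intros r _.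
    apply (linear_scal (T (Rmax 0 r))). apply (c0_bounded _ hT), Rmax_l.
  - destruct (semigroup_locally_bounded T hT t) as [M [HM Hb]].
    exists (t * M + 1). split; [nra|]. intros f.
    apply Rle_trans with ((t - 0) * (M * norm f)).
    + apply integral_norm_le; auto; [apply (orbit_continuous T hT)|].
      intros r Hr. rewrite orbit_eq by lra. apply Hb. lra.
    + assert (H := norm_ge_0 f). nra.
Qed.

Lemma integrated_commutes t h f :
  0 <= t -> 0 <= h -> integrated t (T h f) = T h (integrated t f).
Proof.
  intros Ht Hh. unfold integrated.
  rewrite <- (integral_linear (T h)); [|apply (c0_bounded _ hT); auto|apply (orbit_continuous T hT)].
  apply integral_ext; auto. intros r Hr. rewrite !orbit_eq by lra.
  rewrite <- !(c0_plus _ hT) by lra. f_equal. ring.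
Qed.

(** Applying [T h - I] to the integral over [0, t] shifts the interval and leaves the integral over
    [t, t + h] minus that over [0, h]; divided by [h], these tend to the integrand at [t] and at
    0. *)
Lemma generator_integrated t f :
  0 <= t -> generator T (integrated t f) (minus (T t f) f).
Proof.
  intros Ht. set (u := orbit T f).
  assert (Hu : forall r, continuous u r) by apply (orbit_continuous T hT).
  assert (Hq := lim_plus _ _ _ _ (integral_difference_quotient u t Hu)
    (lim_linear (fun x => (- (1)) *: x) _ _ (linear_scal_C _) (integral_difference_quotient u 0 Hu))).
  assert (e : plus (u t) ((- (1)) *: u 0) = minus (T t f) f).
  { unfold u. rewrite !orbit_eq by lra. rewrite (c0_zero _ hT). cmodule. }
  rewrite e in Hq. refine (filterlim_ext_loc _ _ _ Hq).
  apply (at_right_0_intro _ 1); [lra|]. intros h Hh.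
  assert (e1 : T h (integrated t f) = integral u h (t + h)).
  { rewrite <- integrated_commutes by lra. rewrite <- integral_shift by auto.
    unfold integrated. apply integral_ext; auto. intros r Hr. unfold u.
    rewrite !orbit_eq by lra. rewrite <- (c0_plus _ hT) by lra. reflexivity. }
  rewrite e1. unfold integrated. fold u. rewrite Rplus_0_l.
  assert (H1 := integral_chasles u 0 h (t + h) Hu).
  assert (H2 := integral_chasles u 0 t (t + h) Hu).
  assert (e2 : integral u h (t + h) =
    minus (plus (integral u 0 t) (integral u t (t + h))) (integral u 0 h)).
  { rewrite H2, <- H1. cmodule. }
  rewrite e2. cmodule.
Qed.

(** No differentiation of the orbit at positive times: the bounded operator [integrated t] is
    applied to the difference quotients of [x], and commuting it past [T h] produces the quotients
    of [generator_integrated]. *)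
Lemma integrated_generator t x y :
  0 <= t -> generator T x y -> integrated t y = minus (T t x) x.
Proof.
  intros Ht H.
  assert (HS := integrated_linear t Ht).
  apply (@filterlim_locally_unique R C_AbsRing E (at_right 0) _
    (fun h => integrated t (RtoC (/ h) *: minus (T h x) x))).
  - exact (lim_linear _ _ _ HS H).
  - refine (filterlim_ext_loc _ _ _ (generator_integrated t x Ht)).
    apply (at_right_0_intro _ 1); [lra|]. intros h Hh.
    rewrite (linear_scal _ HS). f_equal. symmetry.
    etransitivity; [apply (linear_minus _ _ _ HS)|].
    rewrite integrated_commutes by lra. reflexivity.
Qed.

(* [R(0, A) = (int_0^1 T(r) dr) (I - T(1))^{-1}], the inverse being a Neumann series. *)
Lemma resolvent_of_contraction (q : R) :
  0 <= q < 1 -> (forall f, norm (T 1 f) <= q * norm f) ->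
  exists B, is_resolvent (generator T) (RtoC 0) B /\
    forall K : E -> Prop, closed_cone K -> (forall t, 0 <= t -> preserves K (T t)) -> preserves K B.
Proof.
  intros Hq HT1.
  assert (L1 : is_linear (T 1)) by (apply (c0_bounded _ hT); lra).
  assert (LS := integrated_linear 1 Rle_0_1).
  (* Injectivity of [I - T(1)] allows the linearity of [N] and its commutation with [integrated 1]
     to be checked after applying [I - T(1)], without returning to the series. *)
  assert (Hinj : forall x y, minus x (T 1 x) = minus y (T 1 y) -> x = y).
  { intros x y H. apply eq_of_norm_lt. intros eps Heps.
    assert (e : minus x y = T 1 (minus x y)).
    { rewrite (linear_minus _ _ _ L1).
      transitivity (plus (minus (minus x (T 1 x)) (minus y (T 1 y))) (minus (T 1 x) (T 1 y)));
        [cmodule|]. rewrite H. cmodule. }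
    assert (H1 := HT1 (minus x y)). rewrite <- e in H1.
    assert (H2 := norm_ge_0 (minus x y)). nra. }
  assert (Hser : forall f, exists z, is_series (fun k => Nat.iter k (T 1) f) z).
  { intros f. apply (@ex_series_le C_AbsRing E _ (fun k => norm f * q ^ k)).
    - intros k. rewrite Rmult_comm. apply norm_iter; auto. lra.
    - apply (@ex_series_scal R_AbsRing R_NormedModule (norm f)). apply ex_series_geom.
      rewrite Rabs_pos_eq; lra. }
  set (N := fun f => proj1_sig (constructive_indefinite_description _ (Hser f))).
  assert (HNs : forall f, is_series (fun k => Nat.iter k (T 1) f) (N f)).
  { intros f. unfold N. destruct (constructive_indefinite_description _ (Hser f)); auto. }
  clearbody N.
  assert (HN : forall f, minus (N f) (T 1 (N f)) = f).
  { intros f.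
    apply (@filterlim_locally_unique nat C_AbsRing E eventually _
      (fun n => minus (sum_n (fun k => Nat.iter k (T 1) f) n)
                      (T 1 (sum_n (fun k => Nat.iter k (T 1) f) n)))).
    - apply (lim_ext (fun n => plus (sum_n (fun k => Nat.iter k (T 1) f) n)
        ((- (1)) *: T 1 (sum_n (fun k => Nat.iter k (T 1) f) n)))); [intros n; cmodule|].
      assert (e : minus (N f) (T 1 (N f)) = plus (N f) ((- (1)) *: T 1 (N f))) by cmodule.
      rewrite e. apply lim_plus; [exact (HNs f)|].
      apply (lim_linear (fun x => (- (1)) *: x)); [apply linear_scal_C|].
      apply lim_linear; auto. exact (HNs f).
    - refine (proj2 (filterlim_norm_iff _ _) _). intros eps Heps.
      assert (Hev := eventually_geom_lt q (norm f) eps Hq (norm_ge_0 f) Heps).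
      revert Hev. apply filter_imp. intros n Hn.
      assert (e : T 1 (sum_n (fun k => Nat.iter k (T 1) f) n) =
        plus (minus (sum_n (fun k => Nat.iter k (T 1) f) n) f) (Nat.iter (S n) (T 1) f)).
      { clear Hn. induction n as [|n IH].
        - rewrite !sum_O. simpl. cmodule.
        - rewrite sum_Sn, (linear_plus _ L1), IH. simpl. cmodule. }
      apply Rle_lt_trans with (norm (Nat.iter (S n) (T 1) f)).
      + right. rewrite <- nrm_opp. apply f_equal. rewrite e. cmodule.
      + apply Rle_lt_trans with (2 := Hn).
        apply Rle_trans with (q ^ S n * norm f); [apply norm_iter; auto; lra|].
        apply Rmult_le_compat_r; [apply norm_ge_0|]. simpl.
        assert (0 <= q ^ n) by (apply pow_le; lra). nra. }
  assert (LN : is_linear N).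
  { split.
    - intros x y. apply Hinj. rewrite HN, (linear_plus _ L1).
      transitivity (plus (minus (N x) (T 1 (N x))) (minus (N y) (T 1 (N y)))); [|cmodule].
      rewrite !HN. reflexivity.
    - intros c x. apply Hinj. rewrite HN, (linear_scal _ L1).
      transitivity (c *: minus (N x) (T 1 (N x))); [|cmodule].
      rewrite !HN. reflexivity.
    - exists (/ (1 - q)). assert (Hq' : 0 < / (1 - q)) by (apply Rinv_0_lt_compat; lra).
      split; auto. intros f.
      assert (H1 := nrm_le_plus_minus (N f) (T 1 (N f))). rewrite HN in H1.
      assert (H2 := HT1 (N f)).
      apply Rmult_le_reg_l with (1 - q); [lra|].
      rewrite <- Rmult_assoc, Rinv_r, Rmult_1_l by lra. lra. }
  assert (HSN : forall f, integrated 1 (N f) = N (integrated 1 f)).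
  { intros f. apply Hinj. rewrite HN, <- integrated_commutes by lra.
    rewrite <- (linear_minus _ _ _ LS). f_equal. apply HN. }
  exists (fun f => integrated 1 (N f)). split; [split; [|split]|].
  - apply (is_linear_comp N (integrated 1)); auto.
  - intros f. exists (minus (T 1 (N f)) (N f)). split; [apply generator_integrated; lra|].
    rewrite <- (HN f) at 4. cmodule.
  - intros x y Hxy. rewrite HSN.
    assert (e : minus (RtoC 0 *: x) y = (- (1)) *: y) by cmodule.
    assert (e2 : integrated 1 ((- (1)) *: y) = (- (1)) *: minus (T 1 x) x).
    { rewrite <- (integrated_generator 1 x y Rle_0_1 Hxy). apply (linear_scal _ LS). }
    rewrite e, e2. apply Hinj. rewrite HN. cmodule.
  - intros K HK Hp g Hg. apply (integral_cone K (orbit T (N g)) 0 1); auto;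
      [lra|apply (orbit_continuous T hT)|].
    intros r. apply Hp; [apply Rmax_l|].
    apply (cone_lim K HK (F := eventually) (sum_n (fun k => Nat.iter k (T 1) g))); [exact (HNs g)|].
    intros n. apply cone_sum; auto. intros k. apply cone_iter; auto. apply Hp. lra.
Qed.

End IntegratedSemigroup.

(** * Rescaled semigroups *)

(* [exp (- la t)] *)
Definition cexp_neg (la : C) (t : R) : C :=
  (exp (- (Re la * t)) * cos (Im la * t), - (exp (- (Re la * t)) * sin (Im la * t))).

Lemma cexp_neg_0 la : cexp_neg la 0 = RtoC 1.
Proof.
  unfold cexp_neg. rewrite !Rmult_0_r, Ropp_0, exp_0, cos_0, sin_0.
  apply injective_projections; simpl; ring.
Qed.

Lemma cexp_neg_plus la s t : cexp_neg la (s + t) = (cexp_neg la s * cexp_neg la t)%C.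
Proof.
  unfold cexp_neg. rewrite !Rmult_plus_distr_l, Ropp_plus_distr, exp_plus, cos_plus, sin_plus.
  apply injective_projections; simpl; ring.
Qed.

Lemma cexp_neg_opp la t : (cexp_neg (- la) t * cexp_neg la t)%C = RtoC 1.
Proof.
  unfold cexp_neg. destruct la as [a b]. simpl.
  rewrite !Ropp_mult_distr_l_reverse, cos_neg, sin_neg.
  assert (H1 : exp (- - (a * t)) * exp (- (a * t)) = 1)
    by (rewrite <- exp_plus, Rplus_opp_l, exp_0; reflexivity).
  assert (H2 := sin2_cos2 (b * t)). unfold Rsqr in H2.
  apply injective_projections; simpl.
  - transitivity (exp (- - (a * t)) * exp (- (a * t)) *
      (sin (b * t) * sin (b * t) + cos (b * t) * cos (b * t))); [ring|].
    rewrite H1, H2. ring.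
  - ring.
Qed.

Lemma Cmod_cexp_neg la t : Cmod (cexp_neg la t) = exp (- (Re la * t)).
Proof.
  unfold cexp_neg, Cmod. simpl.
  assert (H2 := sin2_cos2 (Im la * t)). unfold Rsqr in H2.
  set (e := exp (- (Re la * t))).
  transitivity (sqrt (e * e)).
  - f_equal. transitivity (e * e * (sin (Im la * t) * sin (Im la * t) +
      cos (Im la * t) * cos (Im la * t))); [ring|]. rewrite H2. ring.
  - apply sqrt_square. left. apply exp_pos.
Qed.

Lemma cexp_neg_real (a t : R) : cexp_neg (RtoC a) t = RtoC (exp (- (a * t))).
Proof.
  unfold cexp_neg. simpl. rewrite Rmult_0_l, cos_0, sin_0.
  apply injective_projections; simpl; ring.
Qed.

Lemma difference_quotient_at_right (f : R -> R) (l eps : R) :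
  is_derive f 0 l -> 0 < eps -> at_right 0 (fun t => Rabs (/ t * (f t - f 0) - l) < eps).
Proof.
  intros Hf Heps. apply is_derive_Reals in Hf. destruct (Hf eps Heps) as [d Hd].
  apply (at_right_0_intro _ d); [apply cond_pos|]. intros t Ht.
  specialize (Hd t ltac:(lra)). rewrite Rplus_0_l in Hd. rewrite Rmult_comm.
  apply Hd. rewrite Rabs_pos_eq; lra.
Qed.

Lemma cexp_neg_derivative la eps :
  0 < eps -> at_right 0 (fun t => Cmod (RtoC (/ t) * (cexp_neg la t - 1) + la)%C < eps).
Proof.
  intros Heps. set (a := Re la). set (b := Im la).
  assert (H1 : is_derive (fun t => exp (- (a * t)) * cos (b * t)) 0 (- a)).
  { auto_derive; auto. rewrite !Rmult_0_r, Ropp_0, exp_0, cos_0, sin_0. ring. }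
  assert (H2 : is_derive (fun t => - (exp (- (a * t)) * sin (b * t))) 0 (- b)).
  { auto_derive; auto. rewrite !Rmult_0_r, Ropp_0, exp_0, cos_0, sin_0. ring. }
  assert (Heps2 : 0 < eps / 2) by lra.
  apply (fun H => difference_quotient_at_right _ _ _ H Heps2) in H1, H2.
  generalize (filter_and _ _ H1 H2). apply filter_imp. intros t [Ht1 Ht2].
  rewrite Rmult_0_r, Ropp_0, exp_0, Rmult_0_r, cos_0 in Ht1.
  rewrite Rmult_0_r, Ropp_0, exp_0, Rmult_0_r, sin_0 in Ht2.
  set (z := (RtoC (/ t) * (cexp_neg la t - 1) + la)%C).
  assert (Hz : z = (RtoC (Re z) + Ci * RtoC (Im z))%C).
  { destruct z as [p q]. apply injective_projections; simpl; ring. }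
  rewrite Hz. apply Rle_lt_trans with (1 := Cmod_triangle _ _).
  rewrite Cmod_mult, !Cmod_R.
  rewrite Cmod_Ci.
  assert (Hre : Re z = / t * (exp (- (a * t)) * cos (b * t) - 1 * 1) - - a).
  { unfold z, cexp_neg, a, b. simpl. unfold Re, Im. ring. }
  assert (Him : Im z = / t * (- (exp (- (a * t)) * sin (b * t)) - - (1 * 0)) - - b).
  { unfold z, cexp_neg, a, b. simpl. unfold Re, Im. ring. }
  rewrite Hre, Him. lra.
Qed.

Section Rescaling.

Context {E : CompleteNormedModule C_AbsRing}.
Implicit Types (T : R -> E -> E) (la : C).

Lemma lim_scal {S} {F : (S -> Prop) -> Prop} {FF : Filter F} (c : S -> C) (c0 : C) (u : S -> E) x :
  (forall eps, 0 < eps -> F (fun t => Cmod (c t - c0)%C < eps)) ->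
  filterlim u F (locally x) -> filterlim (fun t => c t *: u t) F (locally (c0 *: x)).
Proof.
  intros Hc Hu. eapply filterlim_comp_2; [|exact Hu|exact (@filterlim_scal C_AbsRing E c0 x)].
  apply (@filterlim_locally _ (AbsRing_UniformSpace C_AbsRing) F FF). intros eps.
  exact (Hc eps (cond_pos eps)).
Qed.

Lemma cexp_neg_cont_0 la eps :
  0 < eps -> at_right 0 (fun t => Cmod (cexp_neg la t - 1)%C < eps).
Proof.
  intros Heps. set (d := eps / (Cmod la + 1)).
  assert (Hla := Cmod_ge_0 la).
  assert (Hd : 0 < d) by (apply Rdiv_lt_0_compat; lra).
  assert (Hs : at_right 0 (fun t => 0 < t < d)) by (apply (at_right_0_intro _ d); auto).
  generalize (filter_and _ _ Hs (cexp_neg_derivative la 1 Rlt_0_1)). apply filter_imp.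
  intros t [Ht H].
  assert (Hnz : RtoC t <> 0) by (intros H0; injection H0; lra).
  assert (e : (cexp_neg la t - 1)%C =
    (RtoC t * ((RtoC (/ t) * (cexp_neg la t - 1) + la) + - la))%C).
  { rewrite RtoC_inv by lra. field. exact Hnz. }
  rewrite e, Cmod_mult, Cmod_R, Rabs_pos_eq by lra.
  assert (H1 := Cmod_triangle (RtoC (/ t) * (cexp_neg la t - 1) + la)%C (- la)%C).
  rewrite Cmod_opp in H1.
  apply Rle_lt_trans with (t * (1 + Cmod la)).
  - apply Rmult_le_compat_l; lra.
  - apply Rlt_le_trans with (d * (1 + Cmod la)).
    + apply Rmult_lt_compat_r; lra.
    + right. unfold d. field. lra.
Qed.

(** Its generator is [A - la], which moves questions at [la] to the point 0. *)
Definition rescale la T : R -> E -> E := fun t f => cexp_neg la t *: T t f.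

Lemma rescale_semigroup la T : C0_semigroup T -> C0_semigroup (rescale la T).
Proof.
  intros hT. unfold rescale. split.
  - intros t Ht. apply (is_linear_comp (T t) (fun x => scal (cexp_neg la t : C_AbsRing) x)).
    + apply (c0_bounded _ hT). exact Ht.
    + apply linear_scal_C.
  - intros f. rewrite (c0_zero _ hT), cexp_neg_0. cmodule.
  - intros s t f Hs Ht. rewrite (c0_plus _ hT) by auto.
    rewrite (linear_scal _ (c0_bounded _ hT s Hs)), cexp_neg_plus. cmodule.
  - intros f. assert (e : RtoC 1 *: f = f) by cmodule.
    assert (H := lim_scal _ _ _ _ (cexp_neg_cont_0 la) (c0_cont _ hT f)).
    rewrite e in H. exact H.
Qed.

Lemma generator_eq T x y y' : generator T x y -> y = y' -> generator T x y'.
Proof. intros H <-. exact H. Qed.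

(** Stated for two semigroups linked by the exponential factor, so that it serves both for [la] from
    [T] and for [- la] back to [T]. *)
Lemma generator_rescale la (T1 T2 : R -> E -> E) x y :
  (forall t f, 0 < t -> T2 t f = cexp_neg la t *: T1 t f) ->
  generator T1 x y -> generator T2 x (minus y (la *: x)).
Proof.
  intros H12 H. unfold generator in *.
  assert (H1 := lim_scal (F := at_right 0) (cexp_neg la) 1 _ _ (cexp_neg_cont_0 la) H).
  assert (H2 : filterlim (fun t => (RtoC (/ t) * (cexp_neg la t - 1)) *: x) (at_right 0)
    (locally ((- la) *: x))).
  { apply (lim_scal (F := at_right 0) (fun t => (RtoC (/ t) * (cexp_neg la t - 1))%C) (- la)
      (fun _ => x)); [|apply filterlim_const].
    intros eps Heps. generalize (cexp_neg_derivative la eps Heps). apply filter_imp.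
    intros t Ht.
    replace (RtoC (/ t) * (cexp_neg la t - 1) - - la)%C
      with (RtoC (/ t) * (cexp_neg la t - 1) + la)%C by ring. exact Ht. }
  assert (e : minus y (la *: x) = plus (RtoC 1 *: y) ((- la) *: x)) by cmodule.
  rewrite e. refine (filterlim_ext_loc _ _ _ (lim_plus _ _ _ _ H1 H2)).
  apply (at_right_0_intro _ 1); [lra|]. intros t Ht.
  rewrite H12 by lra. cmodule.
Qed.

Lemma generator_rescale_iff la T x y :
  generator (rescale la T) x y <-> generator T x (plus y (la *: x)).
Proof.
  split; intros H.
  - assert (H1 := generator_rescale (- la) (rescale la T) T x y).
    assert (e : plus y (la *: x) = minus y ((- la) *: x)) by cmodule.
    rewrite e. apply H1; auto. intros t f _. unfold rescale.
    transitivity ((cexp_neg (- la) t * cexp_neg la t) *: T t f); [|cmodule].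
    rewrite cexp_neg_opp. cmodule.
  - assert (e : y = minus (plus y (la *: x)) (la *: x)) by cmodule.
    rewrite e. apply (generator_rescale la T); auto.
Qed.

Lemma resolvent_rescale la T B :
  is_resolvent (generator (rescale la T)) (RtoC 0) B -> is_resolvent (generator T) la B.
Proof.
  intros [HB [H1 H2]]. split; auto. split.
  - intros f. destruct (H1 f) as [g [Hg He]].
    exists (plus g (la *: B f)). split; [apply generator_rescale_iff; exact Hg|].
    rewrite <- He at 3. cmodule.
  - intros x y Hxy.
    assert (e : minus (la *: x) y = minus (RtoC 0 *: x) (minus y (la *: x))) by cmodule.
    rewrite e. apply H2. apply generator_rescale_iff.
    apply (generator_eq T x y); [exact Hxy|cmodule].
Qed.

(** If [M] bounds [T(1)], the rescaled operator at time 1 has norm at most [exp (- Re la) M], a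
    contraction as soon as [Re la > ln M]. *)
Lemma semigroup_resolvent T : C0_semigroup T ->
  exists w : R, forall la : C, w < Re la ->
    exists B, is_resolvent (generator T) la B /\
      forall K : E -> Prop, closed_cone K ->
        (forall t, 0 <= t -> preserves K (rescale la T t)) -> preserves K B.
Proof.
  intros hT. destruct (linear_norm _ (c0_bounded _ hT 1 Rle_0_1)) as [M [HM Hb]].
  exists (ln M). intros la Hla.
  assert (Hq : exp (- Re la) * M < 1).
  { rewrite <- (exp_ln M HM) at 1. rewrite <- exp_plus, <- exp_0.
    apply exp_increasing. lra. }
  assert (Hpos := exp_pos (- Re la)).
  destruct (resolvent_of_contraction (rescale la T) (rescale_semigroup la T hT)
    (exp (- Re la) * M)) as [B [HB HK]].
  - split; auto. apply Rmult_le_pos; lra.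
  - intros f. unfold rescale. apply Rle_trans with (1 := nrm_scal _ _).
    rewrite Cmod_cexp_neg, Rmult_1_r, Rmult_assoc.
    apply Rmult_le_compat_l; [lra|apply Hb].
  - exists B. split; [apply resolvent_rescale; exact HB|exact HK].
Qed.

(** The generator of the rescaled semigroup kills [v], and integrating this relation over [0, t]
    shows that [v] is fixed. *)
Lemma eigenvector_orbit T mu v t :
  C0_semigroup T -> generator T v (mu *: v) -> 0 <= t -> cexp_neg mu t *: T t v = v.
Proof.
  intros hT Hv Ht.
  assert (Hg : generator (rescale mu T) v zero).
  { apply generator_rescale_iff.
    apply (generator_eq T v (mu *: v)); [exact Hv|cmodule]. }
  assert (hR := rescale_semigroup mu T hT).
  assert (H := integrated_generator _ hR t _ _ Ht Hg).
  assert (H0 : integrated (rescale mu T) t zero = zero)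
    by apply (linear_zero _ (integrated_linear _ hR t Ht)).
  transitivity (plus (minus (rescale mu T t v) v) v); [unfold rescale; cmodule|].
  rewrite <- H, H0. cmodule.
Qed.

End Rescaling.

(** * Eventually positive semigroups *)

Section EventuallyPositive.

Context {E : ComplexBanachLattice} (T : R -> E -> E) (hT : C0_semigroup T).

(** The largest subset of the positive cone that is invariant under the semigroup. It is closed as
    an intersection of preimages of the positive cone under the continuous maps [T t]. *)
Definition stays_positive (g : E) : Prop := forall t, 0 <= t -> is_positive (T t g).

Lemma stays_positive_pos g : stays_positive g -> is_positive g.
Proof. intros H. rewrite <- (c0_zero _ hT g). apply H. lra. Qed.

Lemma stays_positive_cone : closed_cone stays_positive.
Proof.
  split.
  - intros t Ht. assert (e : T t zero = zero) by apply (linear_zero _ (c0_bounded _ hT t Ht)).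
    rewrite e. apply pos_zero.
  - intros x y Hx Hy t Ht. rewrite (linear_plus _ (c0_bounded _ hT t Ht)).
    apply pos_plus; auto.
  - intros a x Ha Hx t Ht. rewrite (linear_scal _ (c0_bounded _ hT t Ht)).
    apply pos_scal; auto.
  - intros x Hx t Ht.
    assert (Hc : closed (fun g => is_positive (T t g))).
    { apply closed_comp; [|apply pos_closed].
      intros y. apply (linear_cont (T t)). apply (c0_bounded _ hT t Ht). }
    apply Hc. intros Hl. apply Hx. revert Hl. apply filter_imp.
    intros y Hy Hs. apply Hy, Hs, Ht.
Qed.

Lemma stays_positive_norm x p :
  stays_positive (minus p x) -> stays_positive (plus p x) -> norm x <= norm p.
Proof. intros H1 H2. apply norm_le_of_pos; apply stays_positive_pos; auto. Qed.

Lemma stays_positive_rescale (a t : R) :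
  0 <= t -> preserves stays_positive (rescale (RtoC a) T t).
Proof.
  intros Ht g Hg s Hs. unfold rescale.
  rewrite (linear_scal _ (c0_bounded _ hT s Hs)), cexp_neg_real.
  apply pos_scal; [left; apply exp_pos|]. rewrite <- (c0_plus _ hT) by auto.
  apply Hg. lra.
Qed.

End EventuallyPositive.

Theorem theorem7p7 (E : ComplexBanachLattice) (T : R -> E -> E)
    (A : E -> E -> Prop) (m : nat)
    (hT : C0_semigroup T)
    (hA : A = generator T)
    (hpos : individually_eventually_positive T)
    (hs : Rbar_lt m_infty (spectral_bound A))
    (hm : is_resolvent_pole A (RtoC (real (spectral_bound A))) m) :
  (exists f : E,
     is_positive f /\ is_eigenvector A (RtoC (real (spectral_bound A))) f) /\
  (forall (lambda : C) (k : nat),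
     peripheral_spectrum A lambda -> is_resolvent_pole A lambda k ->
     (k <= m)%nat).
Proof.
  assert (Hlub := Lub_Rbar_correct (fun r => exists lambda, spectrum A lambda /\ r = Re lambda)).
  fold (spectral_bound A) in Hlub. destruct Hlub as [Hub Hleast].
  destruct (semigroup_resolvent T hT) as [w Hw]. rewrite <- hA in Hw.
  (* [real] sends infinite values to 0, so finiteness comes first: [hs] excludes the lower end, and
     the half plane to the right of [w] lies in the resolvent set. *)
  assert (Hfin : exists s : R, spectral_bound A = Finite s).
  { assert (Hle : Rbar_le (spectral_bound A) (Finite w)).
    { apply Hleast. intros r [la [Hsp ->]]. apply Rnot_lt_le. intros Hlt.
      apply Hsp. destruct (Hw la Hlt) as [B [HB _]]. eauto. }
    destruct (spectral_bound A) as [s| |]; simpl in *; try contradiction. eauto. }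
  destruct Hfin as [s Hseq]. unfold peripheral_spectrum. rewrite Hseq in *. simpl real in *.
  clear hs Hleast.
  assert (Hres : forall la : C, s < Re la -> exists B, is_resolvent A la B).
  { intros la Hla. apply NNPP. intros Hno.
    assert (H : Rbar_le (Finite (Re la)) (Finite s)) by (apply Hub; exists la; split; auto).
    simpl in H. lra. }
  set (K := stays_positive T). assert (HK := stays_positive_cone T hT : closed_cone K).
  assert (HresR : forall t : R, s < t -> exists B, is_resolvent A (RtoC t) B)
    by (intros t Ht; apply Hres; exact Ht).
  assert (Hlarge : forall t B, w + 1 <= t -> is_resolvent A (RtoC t) B -> preserves K B).
  { intros t B Ht HB g Hg. destruct (Hw (RtoC t)) as [B' [HB' Hp]]; [simpl; lra|].
    rewrite (resolvent_unique A _ B B' g HB HB'). apply (Hp K HK); auto.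
    intros r Hr. apply stays_positive_rescale; auto. }
  assert (HP := resolvent_preserves_left K HK A s (w + 1) HresR Hlarge).
  destruct (pole_leading_coefficient A _ m hm) as [Hm1 [U [HUlin [[f0 Hf0] HU]]]].
  assert (Hcomm : forall t x y, 0 <= t -> A x y -> A (T t x) (T t y)).
  { intros t x y Ht. rewrite hA. apply generator_commutes; auto. }
  (* On the range of a leading coefficient [V] at [la] the semigroup acts as [exp (la t)]. *)
  assert (Hshift : forall la k V f t, (1 <= k)%nat -> leading_coefficient A la k V -> 0 <= t ->
    V f = scal (cexp_neg la t : C_AbsRing) (V (T t f))).
  { intros la k V f t Hk HV Ht.
    rewrite (leading_coefficient_commute A la k V (T t) f HV (c0_bounded _ hT t Ht)
      (fun x y => Hcomm t x y Ht)).
    symmetry. apply eigenvector_orbit; auto. rewrite <- hA.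
    apply (leading_coefficient_eigen A la k); auto. }
  (* Every vector is a complex combination of four positive ones, so a linear operator that vanishes
     on positive vectors is zero. *)
  assert (Hspan : forall V : E -> E, is_linear V -> (exists f, V f <> zero) ->
    exists f, is_positive f /\ V f <> zero).
  { intros V HV [f Hf]. apply NNPP. intros Hno.
    assert (H0 : forall p, is_positive p -> V p = zero).
    { intros p Hp. apply NNPP. intros H. apply Hno. eauto. }
    apply Hf. destruct (pos_span f) as [p1 [p2 [p3 [p4 [H1 [H2 [H3 [H4 ->]]]]]]]].
    rewrite (linear_plus _ HV), (linear_scal _ HV), !(linear_minus _ _ _ HV), !H0 by auto.
    cmodule. }
  assert (Hright : at_right 0 (fun e => 0 < e)).
  { apply (at_right_0_intro _ 1); [lra|]. intros; lra. }
  split.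
  - destruct (Hspan U HUlin (ex_intro _ f0 Hf0)) as [f [Hf Hne]].
    exists (U f). split; [|split; auto; apply (leading_coefficient_eigen A _ m); auto].
    destruct (hpos f Hf) as [t0 [Ht0 Hev]].
    (* As [s] is real, the factor gained by passing from [f] to [T t0 f] is a positive number,
       harmless for positivity. *)
    rewrite (Hshift _ _ _ f t0 Hm1 HU Ht0), cexp_neg_real.
    apply pos_scal; [left; apply exp_pos|].
    apply (stays_positive_pos T hT).
    assert (Hg : K (T t0 f)).
    { intros t Ht. rewrite <- (c0_plus _ hT) by auto. apply Hev. lra. }
    destruct HU as [HUres HUlim].
    (* A neighbourhood of the limit that avoids [K] would contain [e ^ m R(s + e) g] for some small
       [e > 0], and this vector lies in [K]. *)
    apply (cone_closed _ HK). intros Hloc.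
    assert (H1 := HUlim (T t0 f) _ Hloc).
    destruct (filter_ex _ (filter_and _ _ (filter_and _ _ HUres Hright) H1)) as [e [[He1 He2] He3]].
    apply He3. apply (cone_scal _ HK); [apply pow_le; lra|].
    rewrite <- RtoC_plus in *. apply (HP (s + e) _ ltac:(lra) He1). exact Hg.
  - intros la k [_ Hla] Hk. injection Hla as Hla.
    destruct (pole_leading_coefficient A la k Hk) as [Hk1 [V [HVlin [HVne HV]]]].
    apply Nat.nlt_ge. intros Hmk.
    destruct (Hspan V HVlin HVne) as [f [Hf Hne]]. apply Hne.
    destruct (hpos f Hf) as [t0 [Ht0 Hev]].
    rewrite (Hshift la k V f t0 Hk1 HV Ht0).
    set (g := T t0 f).
    assert (Hg : K g).
    { intros t Ht. unfold g. rewrite <- (c0_plus _ hT) by auto. apply Hev. lra. }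
    assert (HVg : V g = zero); [|rewrite HVg; cmodule].
    destruct HV as [HVres HVlim].
    apply (@filterlim_locally_unique R C_AbsRing E (at_right 0) _
      (fun e => scal (RtoC (e ^ k) : C_AbsRing) (resolvent_at A (la + RtoC e) g))); [exact (HVlim g)|].
    assert (Hdom : forall e, 0 < e -> is_resolvent A (la + RtoC e)%C (resolvent_at A (la + RtoC e)) ->
      norm (resolvent_at A (la + RtoC e) g) <= 2 * norm (resolvent_at A (RtoC (s + e / 2)) g)).
    { intros e He HB.
      (* With [p = l1 - s - e] and [b = Im la], domination asks for [p^2 + b^2 < (p + e/2)^2], that
         is [b^2 < e p + e^2/4]; this follows from [p >= b^2/e + 1]. *)
      set (l1 := Rmax (Rmax (w + 1) (s + e)) (s + e + Im la * Im la / e + 1)).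
      assert (Hl1 : s + e <= l1) by (eapply Rle_trans; [apply Rmax_r|apply Rmax_l]).
      assert (Hl2 : s + e + Im la * Im la / e + 1 <= l1) by apply Rmax_r.
      destruct (HresR l1) as [B1 HB1]; [lra|].
      assert (HBmu := resolvent_atP A (RtoC (s + e / 2)) (HresR (s + e / 2) ltac:(lra))).
      apply (resolvent_domination K HK A (stays_positive_norm T hT) (s + e / 2) l1
        (la + RtoC e)%C _ B1); auto.
      - set (p := l1 - s - e).
        assert (Hp : Im la * Im la / e + 1 <= p) by (unfold p; lra).
        assert (Hsq : 0 <= Im la * Im la / e).
        { apply Rdiv_le_0_compat; auto. apply Rle_0_sqr. }
        assert (Hq : Im la * Im la <= e * p).
        { apply Rmult_le_reg_r with (/ e); [apply Rinv_0_lt_compat; auto|].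
          replace (e * p * / e) with p by (field; lra). unfold Rdiv in Hp. lra. }
        replace (l1 - (s + e / 2)) with (p + e / 2) by (unfold p; lra).
        unfold Cmod.
        assert (e1 : fst (RtoC l1 - (la + RtoC e))%C = p).
        { unfold p. rewrite <- Hla. simpl. unfold Re. ring. }
        assert (e2 : snd (RtoC l1 - (la + RtoC e))%C = - Im la).
        { simpl. unfold Im. ring. }
        rewrite e1, e2. rewrite <- (sqrt_square (p + e / 2)) by lra.
        apply sqrt_lt_1_alt. split; nra.
      - apply (HP (s + e / 2)); auto. lra.
      - apply (HP l1); auto. lra. }
    destruct HU as [HUres HUlim].
    assert (Hbd := lim_norm_bounded _ _ (HUlim g)).
    set (M := norm (U g) + 1) in Hbd.
    assert (Hhalf : at_right 0 (fun e => norm (scal (RtoC ((e / 2) ^ m) : C_AbsRing)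
       (resolvent_at A (RtoC s + RtoC (e / 2)) g)) <= M)).
    { destruct Hbd as [d Hd]. apply (at_right_0_intro _ d); [apply cond_pos|].
      intros e He. apply Hd; [|lra].
      unfold ball; simpl. unfold AbsRing_ball, abs, minus, plus, opp; simpl.
      apply Rabs_def1; lra. }
    (* Write [e ^ k] as [e ^ (k - m) e ^ m]. The part with [e ^ m] is bounded by [2 * (2 ^ m * M)]:
       the 2 comes from the domination, and [2 ^ m] from [e ^ m = 2 ^ m (e/2) ^ m]. As [k > m], a
       positive power of [e] remains and the limit is zero. *)
    assert (Hz := lim_pow_bounded (k - m)
      (fun e => scal (RtoC (e ^ m) : C_AbsRing) (resolvent_at A (la + RtoC e) g))
      (2 * (2 ^ m * M)) ltac:(lia)).
    refine (filterlim_ext_loc _ _ _ (Hz _)).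
    + apply filter_forall. intros e.
      replace (e ^ k) with (e ^ (k - m) * e ^ m)
        by (rewrite <- pow_add; f_equal; lia).
      rewrite RtoC_mult. cmodule.
    + generalize (filter_and _ _ (filter_and _ _ HVres Hright) Hhalf). apply filter_imp.
      intros e [[He1 He2] He3].
      assert (Hpm : 0 < e ^ m) by (apply pow_lt; auto).
      assert (Hpm2 : 0 < (e / 2) ^ m) by (apply pow_lt; lra).
      apply Rle_trans with (e ^ m * norm (resolvent_at A (la + RtoC e) g)).
      { apply (nrm_scal_R (e ^ m)). lra. }
      rewrite <- RtoC_plus in He3.
      rewrite (nrm_scal_R_eq ((e / 2) ^ m)) in He3 by auto.
      assert (e1 : e ^ m = 2 ^ m * (e / 2) ^ m).
      { rewrite <- Rpow_mult_distr. f_equal. lra. }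
      apply Rle_trans with (e ^ m * (2 * norm (resolvent_at A (RtoC (s + e / 2)) g))).
      { apply Rmult_le_compat_l; [lra|]. apply Hdom; auto. }
      rewrite e1.
      assert (H2 : 0 < 2 ^ m) by (apply pow_lt; lra). nra.
Qed.
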